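(* Let $\hat\pi\in\operatorname{argmax}_{\pi\in\Pi}\min_{m\in\widehat{\mathcal M}_n(\alpha)}\{\hat V(\pi,m)-\hat V(\tilde\pi)\}$ be the empirical safe policy, where $\widehat{\mathcal M}_n(\alpha)$ is a data-dependent model class with $P(\mathcal M\subseteq\widehat{\mathcal M}_n(\alpha))\ge 1-\alpha$. If the baseline policy satisfies $\tilde\pi\in\Pi$ and the true conditional expectation satisfies $m^\ast\in\mathcal M$, then for any $0<\delta\le e^{-1}$, $$V(\tilde\pi)-V(\hat\pi)\ \le\ 6C(K-1)\left[\max_{a\in\mathcal A}\mathcal R_n(\Pi_a)+2\sqrt{\frac1n\log\frac{K-1}{\delta}}\right]$$ with probability at least $1-\alpha-\delta$, where $C=\max_{y\in\{0,1\},\,a\in\mathcal A}|u(y,a)|$.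
   Context: Setting. $\mathcal A=\{0,1,\dots,K-1\}$ ($K\ge2$) is a finite action set and $\mathcal X\subseteq\mathbb R^p$ a covariate space. Units $(\{Y_i(a)\}_{a\in\mathcal A},X_i)$, $i=1,\dots,n$, are i.i.d. copies of $(\{Y(a)\}_{a\in\mathcal A},X)$ with $X\in\mathcal X$ and $Y(a)\in\{0,1\}$. A (deterministic) policy is a map $\pi:\mathcal X\to\mathcal A$; write $\pi(x,a)=\mathbf 1\{\pi(x)=a\}$. $\tilde\pi$ is a known deterministic baseline policy; the observed data are $X_i$, the action $\tilde\pi(X_i)$, and $Y_i=Y_i(\tilde\pi(X_i))$; $Y=Y(\tilde\pi(X))$. $\Pi$ is a class of policies and $\Pi_a=\{\pi(\cdot,a):\pi\in\Pi\}$. Utility. $u(y,a)\in\mathbb R$ is the utility of outcome $y\in\{0,1\}$ under action $a$; $u(a)=u(1,a)-u(0,a)\ge0$ and $c(a)=u(0,a)$. Values. $m^\ast(a,x)=\mathbb E[Y(a)\mid X=x]$ and $\tilde m(x)=m^\ast(\tilde\pi(x),x)=\mathbb E[Y\mid X=x]$. For a function $m$ on $\mathcal A\times\mathcal X$, $$V(\pi,m)=\mathbb E\Big[\sum_{a\in\mathcal A}\pi(X,a)\{u(a)[\tilde\pi(X,a)Y+(1-\tilde\pi(X,a))m(a,X)]+c(a)\}\Big],$$ $$\hat V(\pi,m)=\frac1n\sum_{i=1}^n\sum_{a\in\mathcal A}\pi(X_i,a)\{u(a)[\tilde\pi(X_i,a)Y_i+(1-\tilde\pi(X_i,a))m(a,X_i)]+c(a)\}.$$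 $V(\pi)=V(\pi,m^\ast)$ for a fixed policy, and $V(\hat\pi)$ means this function evaluated at the data-dependent policy $\hat\pi$. $\hat V(\tilde\pi)=\hat V(\tilde\pi,m)$ does not depend on $m$. Model classes. $\mathcal F$ is a given class of functions $\mathcal A\times\mathcal X\to[0,1]$, and the restricted model class is $\mathcal M=\{f\in\mathcal F: f(\tilde\pi(x),x)=\tilde m(x)\ \forall x\in\mathcal X\}$. Rademacher complexity. For a class $\mathcal G$ of real functions on $\mathcal X$, $\mathcal R_n(\mathcal G)=\mathbb E\big[\sup_{g\in\mathcal G}\big|\frac1n\sum_{i=1}^n\varepsilon_i g(X_i)\big|\big]$, with $\varepsilon_i$ i.i.d. uniform on $\{-1,1\}$ independent of the $X_i$. The maximizers and minimizers in the definition of $\hat\pi$ are taken to exist. *)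

(* Defs.v *)
From HB Require Import structures.
From mathcomp Require Import all_boot all_order all_algebra.
From mathcomp Require Import all_classical all_reals all_analysis.
From mathcomp Require Import measurable_realfun.

Set Implicit Arguments.
Unset Strict Implicit.
Unset Printing Implicit Defensive.

Import Order.TTheory GRing.Theory Num.Theory.
Import numFieldNormedType.Exports.

Local Open Scope classical_set_scope.
Local Open Scope ring_scope.

Section Probability.
Context {d : measure_display} {Omega : measurableType d} {R : realType}.
Variable P : probability Omega R.

(* The set A is not assumed to be measurable: the event is asked to contain a
   measurable event of probability at least p. *)
Definition with_prob_ge (p : R) (A : set Omega) : Prop :=
  exists E : set Omega, [/\ measurable E, E `<=` A & (p%:E <= P E)%E].

Lemma with_prob_geE (p : R) (A : set Omega) : measurable A ->
  with_prob_ge p A <-> (p%:E <= P A)%E.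
Proof.
move=> mA; split => [[E [mE EA pE]]|pA]; last by exists A; split.
by apply: (le_trans pE); apply: (le_measure P) => //; exact/mem_set.
Qed.

Context {d' : measure_display} {S : measurableType d'}.

Definition identically_distributed (W W' : {RV P >-> S}) : Prop :=
  forall B : set S, measurable B -> distribution P W B = distribution P W' B.

(* Mutual independence; the product rule over a subfamily is the case where
   the other B i are the full set. *)
Definition mutually_independent (n : nat) (W : 'I_n -> {RV P >-> S}) : Prop :=
  forall B : 'I_n -> set S, (forall i, measurable (B i)) ->
    P (\bigcap_i (W i @^-1` B i)) = (\prod_(i < n) P (W i @^-1` B i))%E.

End Probability.

Section OuterIntegral.
Context {d : measure_display} {S : measurableType d} {R : realType}.
Local Open Scope ereal_scope.

(* Outer integral of a nonnegative function: suprema over uncountable classes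
   need not be measurable, and \int is then only an inner integral. *)
Definition outer_integral (mu : set S -> \bar R) (f : S -> \bar R) : \bar R :=
  ereal_inf [set \int[mu]_x g x | g in
    [set g : S -> \bar R | measurable_fun setT g /\ forall x, f x <= g x]].

Lemma outer_integralE (mu : {measure set S -> \bar R}) (f : S -> \bar R) :
  measurable_fun setT f -> (forall x, 0 <= f x) ->
  outer_integral mu f = \int[mu]_x f x.
Proof.
move=> mf f0; apply/eqP; rewrite eq_le; apply/andP; split.
  by apply: ereal_inf_lbound; exists f.
apply: le_ereal_inf_tmp => _ [g [mg fg] <-].
by apply: ge0_le_integral => //= x _; exact: le_trans (f0 x) (fg x).
Qed.

End OuterIntegral.

Section Rademacher.
Context {d d' : measure_display} {Omega : measurableType d}
  {T : measurableType d'} {R : realType}.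
Variable P : probability Omega R.

(* The signs (-1) ^+ eps i, with eps uniform on the 2 ^ n sign vectors, are
   independent of the sample.  For each eps the expectation is taken under the
   law of (X_1, ..., X_n) on T ^ n; by outer_integralE it is the usual one as
   soon as the supremum is a measurable function on T ^ n. *)
Definition rademacher (n : nat) (X : 'I_n -> Omega -> T) (G : set (T -> R)) :
    \bar R :=
  (((2 ^+ n)^-1)%:E * \sum_(eps : {ffun 'I_n -> bool})
    outer_integral (pushforward P (fun w => [tuple X i w | i < n]))
      (fun x : n.-tuple T => ereal_sup
        [set `| n%:R^-1 * \sum_(i < n) (-1) ^+ eps i * g (tnth x i) |%:E
          | g in G]))%E.

End Rademacher.

Section Policy.
(* The covariate space is an arbitrary measurable space T; a subset of R^p is
   the case of its trace Borel sigma-algebra. *)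
Context {d d' : measure_display} {Omega : measurableType d}
  {T : measurableType d'} {R : realType} {K : nat}.
Variable P : probability Omega R.

Definition policy := T -> 'I_K.
Definition model := 'I_K -> T -> R.

Definition policy_ind (pi : policy) (a : 'I_K) (x : T) : R := (pi x == a)%:R.

Definition policy_class_at (Pi : set policy) (a : 'I_K) : set (T -> R) :=
  [set policy_ind pi a | pi in Pi].

Definition measurable_policy (pi : policy) : Prop :=
  forall a : 'I_K, measurable [set x | pi x = a].

Variable u : bool -> 'I_K -> R.

Definition utility_gain (a : 'I_K) : R := u true a - u false a.
Definition utility_cost (a : 'I_K) : R := u false a.
Definition utility_bound : R :=
  \big[Num.max/0]_(y : bool) \big[Num.max/0]_(a < K) `|u y a|.

Variable pit : policy.  (* baseline policy *)

(* A unit w is the pair of its K binary potential outcomes and its covariate. *)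
Definition observed_outcome (w : K.-tuple bool * T) : bool :=
  tnth w.1 (pit w.2).

Definition score (pi : policy) (m : model) (w : K.-tuple bool * T) : R :=
  \sum_(a < K) policy_ind pi a w.2 *
    (utility_gain a *
       (policy_ind pit a w.2 * (observed_outcome w)%:R
        + (1 - policy_ind pit a w.2) * m a w.2)
     + utility_cost a).

Definition value (W0 : {RV P >-> (K.-tuple bool * T)%type})
    (pi : policy) (m : model) : R :=
  \int[P]_w score pi m (W0 w).

Definition empirical_value (n : nat)
    (W : 'I_n -> {RV P >-> (K.-tuple bool * T)%type})
    (w : Omega) (pi : policy) (m : model) : R :=
  n%:R^-1 * \sum_(i < n) score pi m (W i w).

Lemma empirical_value_baseline (n : nat)
    (W : 'I_n -> {RV P >-> (K.-tuple bool * T)%type})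
    (w : Omega) (m m' : model) :
  empirical_value W w pit m = empirical_value W w pit m'.
Proof.
congr (_ * _); apply: eq_bigr => i _; apply: eq_bigr => a _.
by rewrite /policy_ind; case: eqP => _; rewrite ?mul0r// subrr !mul0r.
Qed.

(* m a x is a version of E[Y(a) | X = x], for Y(a) = tnth (W0 w).1 a and
   X = (W0 w).2. *)
Definition is_regression (W0 : {RV P >-> (K.-tuple bool * T)%type})
    (m : model) : Prop :=
  forall a : 'I_K,
    [/\ measurable_fun setT (m a),
        P.-integrable setT (fun w => (m a (W0 w).2)%:E) &
        forall B : set T, measurable B ->
          (\int[P]_(w in [set w | B (W0 w).2]) (m a (W0 w).2)%:E =
           \int[P]_(w in [set w | B (W0 w).2]) ((tnth (W0 w).1 a)%:R)%:E)%E].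

Definition baseline_regression (mstar : model) (x : T) : R := mstar (pit x) x.

Definition restricted_class (F : set model) (mt : T -> R) : set model :=
  [set f | F f /\ forall x, f (pit x) x = mt x].

Definition is_minimum {I : Type} (D : set I) (f : I -> R) (v : R) : Prop :=
  (exists2 i, D i & f i = v) /\ forall i, D i -> v <= f i.

(* pih maximizes over Pi the minimum over m in Mh of J pi m, all minima being
   attained. *)
Definition is_maximin (Pi : set policy) (Mh : set model)
    (J : policy -> model -> R) (pih : policy) : Prop :=
  Pi pih /\ exists worst : policy -> R,
    (forall pi, Pi pi -> is_minimum Mh (J pi) (worst pi)) /\
    (forall pi, Pi pi -> worst pi <= worst pih).

(* The baseline term does not depend on m, by empirical_value_baseline. *)
Definition empirical_safe_policy (n : nat)
    (W : 'I_n -> {RV P >-> (K.-tuple bool * T)%type})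
    (Pi : set policy) (Mh : set model) (w : Omega) (pih : policy) : Prop :=
  is_maximin Pi Mh
    (fun pi m => empirical_value W w pi m - empirical_value W w pit m) pih.

End Policy.

(* Main.v *)
Require Import Defs.
From HB Require Import structures.
From mathcomp Require Import all_boot all_order all_algebra.
From mathcomp Require Import all_classical all_reals all_analysis.
From mathcomp Require Import measurable_realfun.
From mathcomp Require Import ring lra.

(* Let C bound |u|, fix a reference action a0, and write P, Pn for expectation
   under the law of a unit and under the empirical measure.  When the true
   regression lies in the estimated class, the maximin policy is empirically at
   least as good as the baseline for the true regression, so its regret is at
   most Z = sup_pi (P - Pn)(score pit - score pi), the supremum over the class.
   Since pi(x, .) sums to 1, score pi differs from a term independent of pi by
   sum_(a <> a0) 2 C h_a pi(x, a) with |h_a| <= 1.  Symmetrization (one-sided, so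
   that the term of the fixed policy pit has mean zero) and the contraction
   principle give E Z <= 4 C (K - 1) max_a R_n(Pi_a).
   Z need not be measurable; it is replaced by a minimal measurable majorant H,
   which inherits the bounded differences 4 C / n almost everywhere.  Instead of
   the martingale proof of McDiarmid's inequality, the even moments of H - E H are
   bounded by Chatterjee's exchangeable pair argument, which needs only the
   invariance of the product law under swapping coordinates of two independent
   samples; Markov's inequality at the even order 2p, p close to
   log ((K - 1) / delta), then gives the tail. *)

Set Implicit Arguments.
Unset Strict Implicit.
Unset Printing Implicit Defensive.

Import Order.TTheory GRing.Theory Num.Theory.
Import numFieldNormedType.Exports.

Local Open Scope classical_set_scope.
Local Open Scope ring_scope.

(** * Bounded measurable functions *)

Section BoundedMeasurable.
Context {d : measure_display} {T : measurableType d} {R : realType}.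
Implicit Types f g : T -> R.

(** This class is stable under the algebraic operations used below, and its members are integrable
    under any probability, so their real-valued integrals are linear and monotone without further
    side conditions. *)
Definition bounded_measurable f : Prop :=
  measurable_fun setT f /\ exists M : R, forall x, `|f x| <= M.

Lemma eq_bounded_measurable f g : bounded_measurable f -> g =1 f ->
  bounded_measurable g.
Proof. by move=> bf /funext ->. Qed.

Lemma bounded_measurable_cst (r : R) : bounded_measurable (fun _ => r).
Proof. by split; [exact: measurable_cst|exists `|r|]. Qed.

Lemma bounded_measurableD f g : bounded_measurable f -> bounded_measurable g ->
  bounded_measurable (fun x => f x + g x).
Proof.
move=> [mf [M fM]] [mg [N gN]]; split; first exact: measurable_funD.
by exists (M + N) => x; rewrite (le_trans (ler_normD _ _))// lerD.
Qed.

Lemma bounded_measurableN f : bounded_measurable f ->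
  bounded_measurable (fun x => - f x).
Proof.
move=> [mf [M fM]]; split; first exact: measurable_funN.
by exists M => x; rewrite normrN.
Qed.

Lemma bounded_measurableB f g : bounded_measurable f -> bounded_measurable g ->
  bounded_measurable (fun x => f x - g x).
Proof. by move=> bf bg; apply: bounded_measurableD => //; exact: bounded_measurableN. Qed.

Lemma bounded_measurableM f g : bounded_measurable f -> bounded_measurable g ->
  bounded_measurable (fun x => f x * g x).
Proof.
move=> [mf [M fM]] [mg [N gN]]; split; first exact: measurable_funM.
by exists (M * N) => x; rewrite normrM ler_pM.
Qed.

Lemma bounded_measurable_norm f : bounded_measurable f ->
  bounded_measurable (fun x => `|f x|).
Proof.
move=> [mf [M fM]]; split; first exact: measurableT_comp.
by exists M => x; rewrite normr_id.
Qed.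

Lemma bounded_measurableX f n : bounded_measurable f ->
  bounded_measurable (fun x => f x ^+ n).
Proof.
move=> bf; elim: n => [|n IH].
  by apply: (eq_bounded_measurable (bounded_measurable_cst 1)) => x; rewrite expr0.
by apply: (eq_bounded_measurable (bounded_measurableM bf IH)) => x; rewrite exprS.
Qed.

Lemma bounded_measurable_sum (I : Type) (s : seq I) (Q : pred I) (h : I -> T -> R) :
  (forall i, Q i -> bounded_measurable (h i)) ->
  bounded_measurable (fun x => \sum_(i <- s | Q i) h i x).
Proof.
move=> bh; elim: s => [|i s IH].
  by apply: (eq_bounded_measurable (bounded_measurable_cst 0)) => x; rewrite big_nil.
have [Qi|Qi] := boolP (Q i).
  by apply: (eq_bounded_measurable (bounded_measurableD (bh i Qi) IH)) => x; rewrite big_cons Qi.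
by apply: (eq_bounded_measurable IH) => x; rewrite big_cons (negbTE Qi).
Qed.

Lemma bounded_measurable_prod (I : Type) (s : seq I) (Q : pred I) (h : I -> T -> R) :
  (forall i, Q i -> bounded_measurable (h i)) ->
  bounded_measurable (fun x => \prod_(i <- s | Q i) h i x).
Proof.
move=> bh; elim: s => [|i s IH].
  by apply: (eq_bounded_measurable (bounded_measurable_cst 1)) => x; rewrite big_nil.
have [Qi|Qi] := boolP (Q i).
  by apply: (eq_bounded_measurable (bounded_measurableM (bh i Qi) IH)) => x; rewrite big_cons Qi.
by apply: (eq_bounded_measurable IH) => x; rewrite big_cons (negbTE Qi).
Qed.

Lemma bounded_measurable_indic (A : set T) : measurable A ->
  bounded_measurable (\1_A : T -> R).
Proof.
move=> mA; split; first exact: measurable_indic.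
by exists 1 => x; rewrite indicE; case: (_ \in _); rewrite ?normr1 ?normr0.
Qed.

End BoundedMeasurable.

Lemma bounded_measurable_comp {d d' : measure_display} {T : measurableType d}
  {T' : measurableType d'} {R : realType} (f : T' -> R) (h : T -> T') :
  bounded_measurable f -> measurable_fun setT h ->
  bounded_measurable (fun x => f (h x)).
Proof.
move=> [mf [M fM]] mh; split; last by exists M => x.
exact: (measurableT_comp mf mh).
Qed.

(** * Expectations of bounded measurable functions *)

Section Expectation.
Context {d : measure_display} {T : measurableType d} {R : realType}.
Variable m : probability T R.
Implicit Types f g : T -> R.

Lemma bounded_measurable_integrable f : bounded_measurable f ->
  m.-integrable setT (EFin \o f).
Proof.
move=> [mf [M fM]]; apply: measurable_bounded_integrable => //.
  by rewrite (le_lt_trans (probability_le1 _ _))// ltry.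
exists M; split; first exact: num_real.
by move=> N MN x _ /=; rewrite (le_trans (fM x)) ?ltW.
Qed.

Lemma Rintegral_bm_fin f : bounded_measurable f ->
  (\int[m]_x (f x)%:E)%E = (\int[m]_x f x)%:E.
Proof.
by move=> bf; rewrite /Rintegral fineK//; apply: integrable_fin_num => //;
  exact: (bounded_measurable_integrable bf).
Qed.

Lemma Rintegral_bm_cst (r : R) : \int[m]_(x in setT) r = r.
Proof. by rewrite Rintegral_cst//= probability_setT mulr1. Qed.

Lemma Rintegral_bmD f g : bounded_measurable f -> bounded_measurable g ->
  \int[m]_x (f x + g x) = \int[m]_x f x + \int[m]_x g x.
Proof. by move=> bf bg; rewrite RintegralD//; exact: bounded_measurable_integrable. Qed.

Lemma Rintegral_bmB f g : bounded_measurable f -> bounded_measurable g ->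
  \int[m]_x (f x - g x) = \int[m]_x f x - \int[m]_x g x.
Proof. by move=> bf bg; rewrite RintegralB//; exact: bounded_measurable_integrable. Qed.

Lemma Rintegral_bmZ (r : R) f : bounded_measurable f ->
  \int[m]_x (r * f x) = r * \int[m]_x f x.
Proof. by move=> bf; rewrite RintegralZl//; exact: bounded_measurable_integrable. Qed.

Lemma Rintegral_bm_sum (I : Type) (s : seq I) (Q : pred I) (h : I -> T -> R) :
  (forall i, Q i -> bounded_measurable (h i)) ->
  \int[m]_x (\sum_(i <- s | Q i) h i x) = \sum_(i <- s | Q i) \int[m]_x h i x.
Proof.
move=> bh; elim: s => [|i s IH].
  by under eq_Rintegral do rewrite big_nil; rewrite Rintegral_bm_cst big_nil.
under eq_Rintegral do rewrite big_cons.
rewrite big_cons; case: ifPn => // Qi.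
rewrite Rintegral_bmD ?IH//; first exact: bh.
exact: bounded_measurable_sum.
Qed.

Lemma le_Rintegral_bm f g : bounded_measurable f -> bounded_measurable g ->
  (forall x, f x <= g x) -> \int[m]_x f x <= \int[m]_x g x.
Proof. by move=> bf bg fg; apply: le_Rintegral => //; exact: bounded_measurable_integrable. Qed.

(** The difference [g - f] agrees almost everywhere with its absolute value, whose integral is
    nonnegative. *)
Lemma ae_le_Rintegral f g : bounded_measurable f -> bounded_measurable g ->
  {ae m, forall x, f x <= g x} -> \int[m]_x f x <= \int[m]_x g x.
Proof.
move=> bf bg fg; have bgf := bounded_measurableB bg bf.
rewrite -subr_ge0 -Rintegral_bmB//.
suff -> : \int[m]_x (g x - f x) = \int[m]_x `|g x - f x|.
  by apply: Rintegral_ge0.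
congr fine; apply: ae_eq_integral => //.
- by apply/measurable_EFinP; have [] := bgf.
- by apply/measurable_EFinP; have [] := bounded_measurable_norm bgf.
by apply: filterS fg => x fgx _; rewrite ger0_norm// subr_ge0.
Qed.

(** The function [g - f] is nonnegative with integral zero, hence vanishes almost everywhere. *)
Lemma ae_ge_of_Rintegral f g : bounded_measurable f -> bounded_measurable g ->
  (forall x, f x <= g x) -> \int[m]_x g x <= \int[m]_x f x ->
  {ae m, forall x, g x = f x}.
Proof.
move=> bf bg fg gf; have bgf := bounded_measurableB bg bf.
have /(ae_eq_integral_abs m measurableT) : measurable_fun setT (fun x => (g x - f x)%:E).
  by apply/measurable_EFinP; have [] := bgf.
move=> [+ _].
have -> : (\int[m]_x `|(g x - f x)%:E|)%E = 0%E.
  transitivity ((\int[m]_x (g x - f x))%:E).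
    rewrite -Rintegral_bm_fin//; apply: eq_integral => x _.
    by rewrite gee0_abs// lee_fin subr_ge0.
  congr EFin; apply/eqP; rewrite eq_le; apply/andP; split.
    by rewrite Rintegral_bmB// subr_le0.
  by apply: Rintegral_ge0 => x _; rewrite subr_ge0.
move=> /(_ erefl); apply: filterS => x /(_ I) /= [] /eqP.
by rewrite subr_eq0 => /eqP.
Qed.

Lemma Rintegral_indic (A : set T) : measurable A -> \int[m]_x \1_A x = fine (m A).
Proof. by move=> mA; rewrite /Rintegral integral_indic// setIT. Qed.

End Expectation.

Section Transfer.
Context {d d' : measure_display} {T : measurableType d} {T' : measurableType d'}
  {R : realType}.

Lemma Rintegral_distribution (m : probability T R) (h : {mfun T >-> T'})
    (f : T' -> R) : bounded_measurable f ->
  \int[distribution m h]_y f y = \int[m]_x f (h x).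
Proof.
move=> bf; congr fine; rewrite integral_pushforward//.
- by apply/measurable_EFinP; have [] := bf.
- rewrite preimage_setT; apply: (@bounded_measurable_integrable _ _ _ m (fun x => f (h x))).
  exact: bounded_measurable_comp.
Qed.

(** Tonelli's theorem gives the measurability of partial integrals of nonnegative functions; the
    bound [M] is therefore added to [f] and subtracted afterwards. *)
Lemma bounded_measurable_Rintegral (m : probability T' R) (f : T * T' -> R) :
  bounded_measurable f -> bounded_measurable (fun x => \int[m]_y f (x, y)).
Proof.
move=> bf; have [mf [M fM]] := bf.
have mx (x : T) : measurable_fun setT (pair x : T' -> T * T').
  exact: pair1_measurable.
have bx x : bounded_measurable (fun y => f (x, y)).
  exact: (bounded_measurable_comp bf (mx x)).
split.
  have M0 : forall p, (0 <= (f p + M)%:E)%E.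
    by move=> p; rewrite lee_fin -lerBlDr sub0r; have := fM p; rewrite ler_norml => /andP[].
  have mfM : measurable_fun setT (fun p => (f p + M)%:E).
    by apply/measurable_EFinP; apply: measurable_funD => //; exact: measurable_cst.
  have := measurable_fun_fubini_tonelli_F (m2 := m) _ mfM M0.
  rewrite /fubini_F => mF.
  have -> : (fun x => \int[m]_y f (x, y)) =
      (fun x => fine (\int[m]_y (f (x, y) + M)%:E)%E - M).
    apply/funext => x; have := @Rintegral_bmD _ _ _ m _ _ (bx x) (bounded_measurable_cst M).
    by rewrite Rintegral_bm_cst /Rintegral /= => ->; rewrite addrK.
  apply: measurable_funB; last exact: measurable_cst.
  exact: measurableT_comp.
exists M => x; apply: (le_trans (le_normr_Rintegral _ _)) => //.
  exact: bounded_measurable_integrable.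
rewrite -[leRHS](Rintegral_bm_cst m); apply: le_Rintegral_bm => //.
- exact: bounded_measurable_norm.
- exact: bounded_measurable_cst.
Qed.

End Transfer.

Section ProductExpectation.
Context {d d' : measure_display} {T : measurableType d} {T' : measurableType d'}
  {R : realType} (m : probability T R) (m' : probability T' R).

Definition pairp : probability (T * T')%type R := (m \x m')%E.

Lemma Rintegral_product1 (f : T * T' -> R) : bounded_measurable f ->
  \int[pairp]_p f p = \int[m]_x \int[m']_y f (x, y).
Proof.
move=> bf.
have bx x : bounded_measurable (fun y => f (x, y)).
  apply: (bounded_measurable_comp bf).
  exact: pair1_measurable.
congr fine; rewrite /pairp -integral12_prod_meas1/=; last first.
  exact: (@bounded_measurable_integrable _ _ _ pairp).
by apply: eq_integral => x _; rewrite /fubini_F /= Rintegral_bm_fin.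
Qed.

Lemma Rintegral_product2 (f : T * T' -> R) : bounded_measurable f ->
  \int[pairp]_p f p = \int[m']_y \int[m]_x f (x, y).
Proof.
move=> bf.
have bx y : bounded_measurable (fun x => f (x, y)).
  apply: (bounded_measurable_comp bf).
  exact: pair2_measurable.
congr fine; rewrite /pairp -integral21_prod_meas1/=; last first.
  exact: (@bounded_measurable_integrable _ _ _ pairp).
by apply: eq_integral => x _; rewrite /fubini_G /= Rintegral_bm_fin.
Qed.

End ProductExpectation.

(** * Measurable envelopes and independent samples *)

Section Envelope.
Context {d : measure_display} {T : measurableType d} {R : realType}.
Variable m : probability T R.

(* The infimum of a minimizing sequence of majorants is again a majorant. *)
Lemma outer_integral_attained (B : R) (Z : T -> \bar R) :
  (forall x, 0 <= Z x <= B%:E)%E ->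
  exists H : T -> R, [/\ bounded_measurable H,
    forall x, (Z x <= (H x)%:E)%E, forall x, 0 <= H x <= B &
    ((\int[m]_x H x)%:E <= outer_integral m Z)%E].
Proof.
move=> ZB.
(* A point of [T] is needed to get [0 <= B]; if there is none, the pointwise claims are vacuous and
   the zero function serves. *)
have [x0|T0] := pselect (exists x0 : T, True); last first.
  exists (fun=> 0); split; [exact: bounded_measurable_cst|by move=> x; exfalso; apply: T0; exists x
    |by move=> x; exfalso; apply: T0; exists x|].
  rewrite Rintegral_bm_cst; apply: le_ereal_inf_tmp => _ [g [mg Zg] <-].
  by apply: integral_ge0 => x _; rewrite (le_trans _ (Zg x))//; case/andP: (ZB x).
have B0 : 0 <= B.
  by case: x0 => x _; have /andP[a b] := ZB x; rewrite -lee_fin (le_trans a).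
have I0 : (0 <= outer_integral m Z)%E.
  apply: le_ereal_inf_tmp => _ [g [mg Zg] <-].
  by apply: integral_ge0 => x _; rewrite (le_trans _ (Zg x))//; case/andP: (ZB x).
have IB : (outer_integral m Z <= B%:E)%E.
  have <- : (\int[m]_x B%:E)%E = B%:E.
    by rewrite Rintegral_bm_fin ?Rintegral_bm_cst//; exact: bounded_measurable_cst.
  apply: ereal_inf_lbound; exists (fun x => B%:E) => //; split.
    by apply/measurable_EFinP; exact: measurable_cst.
  by move=> x; case/andP: (ZB x).
have Ifin : outer_integral m Z \is a fin_num.
  by rewrite ge0_fin_numE// (le_lt_trans IB)// ltry.
have /choice[g gP] : forall k : nat, exists g : T -> \bar R,
    [/\ measurable_fun setT g, forall x, (Z x <= g x)%E &
      (\int[m]_x g x < outer_integral m Z + (k.+1%:R^-1)%:E)%E].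
  move=> k; have [_ [g [mg Zg] <-] gI] :
      exists2 y, [set \int[m]_x g x | g in [set g : T -> \bar R |
        measurable_fun setT g /\ forall x, Z x <= g x]]%E y &
        (y < outer_integral m Z + (k.+1%:R^-1)%:E)%E.
    by apply: lb_ereal_inf_adherent => //; rewrite invr_gt0.
  by exists g.
(* Truncation at [B] preserves the majorants of [Z] and makes their infimum over [k] finite. *)
pose h (k : nat) (x : T) := mine (g k x) B%:E.
have mh k : measurable_fun setT (h k).
  by apply: measurable_mine; [case: (gP k)|exact: measurable_cst].
have Zh k x : (Z x <= h k x)%E.
  by rewrite /h le_min; have [_ -> _] := gP k; case/andP: (ZB x).
have hB k x : (h k x <= B%:E)%E by rewrite /h ge_min lexx orbT.
pose H x := einfs (h ^~ x) 0.
have mH : measurable_fun setT H by exact: (measurable_fun_einfs mh).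
have ZH x : (Z x <= H x)%E.
  by apply: le_ereal_inf_tmp => _ [k _ <-].
have Hh k x : (H x <= h k x)%E.
  by apply: ereal_inf_lbound; exists k.
have H0 x : (0 <= H x)%E by rewrite (le_trans _ (ZH x))//; case/andP: (ZB x).
have HB x : (H x <= B%:E)%E by rewrite (le_trans (Hh 0%N x)).
have Hfin x : (fine (H x))%:E = H x.
  by rewrite fineK// ge0_fin_numE// (le_lt_trans (HB x))// ltry.
have H0B x : 0 <= fine (H x) <= B by rewrite -!lee_fin Hfin H0 HB.
have bH : bounded_measurable (fun x => fine (H x)).
  split; first exact: measurableT_comp.
  by exists B => x; have /andP[a b] := H0B x; rewrite ger0_norm.
exists (fun x => fine (H x)); split => //; first by move=> x; rewrite Hfin.
rewrite -Rintegral_bm_fin//.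
apply/lee_addgt0Pr => e e0.
(* This index satisfies [1 / (k + 1) < e]. *)
pose k := Num.truncn e^-1.
apply: (@le_trans _ _ (\int[m]_x g k x)%E).
  have [mg Zg _] := gP k; apply: ge0_le_integral => //.
  - by move=> x _; rewrite lee_fin; case/andP: (H0B x).
  - by apply/measurable_EFinP; have [] := bH.
  - by move=> x _; rewrite Hfin (le_trans (Hh k x))// /h ge_min lexx.
have [_ _ /ltW gk] := gP k; apply: (le_trans gk); apply: leeD2l.
rewrite lee_fin invf_ple ?posrE//; exact/ltW/truncnS_gt.
Qed.

(** The pointwise minimum of [H] and [G] is again a measurable majorant of [Z], so its integral is
    at least that of [H]; being below [H], it equals [H] almost everywhere. *)
Lemma envelope_minimal (Z : T -> \bar R) (H G : T -> R) :
  (forall x, 0 <= Z x)%E ->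
  bounded_measurable H -> ((\int[m]_x H x)%:E <= outer_integral m Z)%E ->
  (forall x, (Z x <= (H x)%:E)%E) ->
  measurable_fun setT G -> (forall x, (Z x <= (G x)%:E)%E) ->
  {ae m, forall x, H x <= G x}.
Proof.
move=> Z0 bH Hmin ZH mG ZG.
have bHG : bounded_measurable (fun x => Num.min (H x) (G x)).
  have [mH [M HM]] := bH; split; first exact: measurable_minr.
  exists M => x; have H0 : 0 <= H x by rewrite -lee_fin (le_trans (Z0 x)).
  have G0 : 0 <= G x by rewrite -lee_fin (le_trans (Z0 x)).
  rewrite ger0_norm; first by rewrite (le_trans _ (HM x))// ger0_norm// ge_min lexx.
  by rewrite le_min H0.
have : {ae m, forall x, H x = Num.min (H x) (G x)}.
  apply: ae_ge_of_Rintegral => //; first by move=> x; rewrite ge_min lexx.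
  rewrite -lee_fin (le_trans Hmin)// -Rintegral_bm_fin//.
  apply: ereal_inf_lbound; exists (fun x => (Num.min (H x) (G x))%:E) => //; split.
    by apply/measurable_EFinP; have [] := bHG.
  by move=> x; rewrite EFin_min le_min ZH ZG.
by apply: filterS => x ->; rewrite ge_min lexx orbT.
Qed.

End Envelope.

(** * Pairs of independent samples and swaps of coordinates *)

Section IidSample.
Context {d : measure_display} {S : measurableType d} {R : realType} {n : nat}.
Local Notation sample := (n.-tuple S).

Definition cylinder (B : 'I_n -> set S) : set sample :=
  [set x | forall i, B i (tnth x i)].

(** The product structure is recorded only through the mass of boxes, which is all that the swap
    invariance below needs. *)
Definition iid_law (mu : set S -> \bar R) (nu : set sample -> \bar R) : Prop :=
  forall B : 'I_n -> set S, (forall i, measurable (B i)) ->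
    nu (cylinder B) = (\prod_(i < n) mu (B i))%E.

Lemma measurable_cylinder (B : 'I_n -> set S) : (forall i, measurable (B i)) ->
  measurable (cylinder B).
Proof.
move=> mB.
rewrite (_ : cylinder B = \bigcap_(i in setT) ((@tnth n S)^~ i @^-1` B i)).
  apply: fin_bigcap_measurable => // i _.
  by rewrite -[X in measurable X]setTI; apply: measurable_tnth.
by apply/seteqP; split => [x xB i _|x xB i]; [exact: xB|exact: (xB i I)].
Qed.

(** Hybrid samples, the resampling of one coordinate and random-sign symmetrization are all
    instances of this mixture, for suitable [b]. *)
Definition select (b : 'I_n -> bool) (p : sample * sample) : sample :=
  [tuple if b i then tnth p.1 i else tnth p.2 i | i < n].

(** Coordinates where [b] holds stay in place; the others are exchanged between the two samples. *)
Definition swap_on (b : 'I_n -> bool) (p : sample * sample) : sample * sample :=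
  (select b p, select (fun i => ~~ b i) p).

Lemma measurable_select b : measurable_fun setT (select b).
Proof.
apply/measurable_fun_tnthP => i.
rewrite (_ : _ \o _ = fun p => if b i then tnth p.1 i else tnth p.2 i).
  by case: (b i); apply: (measurableT_comp (measurable_tnth i)).
by apply/funext => p /=; rewrite tnth_mktuple.
Qed.

Lemma measurable_swap_on b : measurable_fun setT (swap_on b).
Proof. by apply: measurable_fun_pair; exact: measurable_select. Qed.

HB.instance Definition _ b := isMeasurableFun.Build _ _ _ _ (swap_on b) (measurable_swap_on b).

(** Products of two boxes are closed under intersection and generate the product sigma-algebra, so a
    probability is determined by its values on them. *)
Lemma eq_measure_cylinders (m1 m2 : probability (sample * sample)%type R) :
  (forall A B : 'I_n -> set S, (forall i, measurable (A i)) ->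
     (forall i, measurable (B i)) ->
     m1 (cylinder A `*` cylinder B) = m2 (cylinder A `*` cylinder B)) ->
  forall X, measurable X -> m1 X = m2 X.
Proof.
move=> m12.
pose C : set (set (sample * sample)) := [set X | exists A B : 'I_n -> set S,
  [/\ forall i, measurable (A i), forall i, measurable (B i) &
    X = cylinder A `*` cylinder B]].
have CT : C setT.
  exists (fun=> setT), (fun=> setT); split => //.
  by apply/seteqP; split.
apply: (measure_unique C (fun=> setT)) => //.
- apply/seteqP; split => [X mX|].
    (* Generation: the identity out of the generated sigma-algebra is measurable because every
       coordinate is, the preimage of [B] under one coordinate being a box whose other factors are
       full. *)
    have mid : measurable_fun setT
        (id : g_sigma_algebraType C -> (sample * sample)%type).
      apply/measurable_fun_pairP; split; apply/measurable_fun_tnthP => i _ B mB;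
        rewrite setTI; apply: sub_sigma_algebra.
      + exists (fun j => if j == i then B else setT), (fun=> setT); split => //.
          by move=> j; case: ifP.
        apply/seteqP; split => [[x y]/= Bx|[x y] [/= /(_ i)]]; last by rewrite eqxx.
        by split => // j /=; case: eqP => [->|].
      + exists (fun=> setT), (fun j => if j == i then B else setT); split => //.
          by move=> j; case: ifP.
        apply/seteqP; split => [[x y]/= Bx|[x y] [/= _ /(_ i)]]; last by rewrite eqxx.
        by split => // j /=; case: eqP => [->|].
    by have := mid measurableT X mX; rewrite setTI.
  apply: smallest_sub; first exact: sigma_algebra_measurable.
  by move=> X [A [B [mA mB ->]]]; apply: measurableX; exact: measurable_cylinder.
- move=> X Y [A [B [mA mB ->]]] [A' [B' [mA' mB' ->]]].
  exists (fun i => A i `&` A' i), (fun i => B i `&` B' i); split.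
  + by move=> i; exact: measurableI.
  + by move=> i; exact: measurableI.
  + rewrite -setXI; congr (_ `*` _);
      by apply/seteqP; split => [x [Ax Ax'] i|x AA']; [|split => i; have [] := AA' i].
- by apply/seteqP; split => // x _; exists 0%N.
- by move=> X [A [B [mA mB ->]]]; exact: m12.
- by move=> _; rewrite (le_lt_trans (probability_le1 _ _))// ltry.
Qed.

Context (mu : set S -> \bar R) (nu : probability sample R).
Hypothesis hnu : iid_law mu nu.

Local Notation nu2 := (pairp nu nu).

(** The preimage of a product of two boxes is again one, with the factors [A i] and [B i] exchanged
    wherever [b] fails; the total product of masses is unchanged. *)
Lemma swap_on_preserving b X : measurable X -> nu2 (swap_on b @^-1` X) = nu2 X.
Proof.
move=> mX; apply: (@eq_measure_cylinders (distribution nu2 (swap_on b)) nu2) => //.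
move=> A B mA mB.
pose A' i := if b i then A i else B i.
pose B' i := if b i then B i else A i.
have E : swap_on b @^-1` (cylinder A `*` cylinder B) = cylinder A' `*` cylinder B'.
  apply/seteqP; split => [[x y] /= [hA hB]|[x y] /= [hA hB]].
    split=> i; move: (hA i) (hB i); rewrite !tnth_mktuple /A' /B';
      by case: (b i).
  split=> i; move: (hA i) (hB i); rewrite !tnth_mktuple /A' /B';
    by case: (b i).
have mA' i : measurable (A' i) by rewrite /A'; case: ifP.
have mB' i : measurable (B' i) by rewrite /B'; case: ifP.
transitivity (nu2 (cylinder A' `*` cylinder B')); first by rewrite -E.
rewrite /= !product_measure1E//; try exact: measurable_cylinder.
transitivity ((\prod_(i < n) mu (A' i)) * (\prod_(i < n) mu (B' i)))%E.
  by congr (_ * _)%E; [exact: (hnu mA')|exact: (hnu mB')].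
transitivity ((\prod_(i < n) mu (A i)) * (\prod_(i < n) mu (B i)))%E; last first.
  by congr (_ * _)%E; [exact/esym/(hnu mA)|exact/esym/(hnu mB)].
rewrite -!big_split/=; apply: eq_bigr => i _.
by rewrite /A' /B'; case: (b i) => //; rewrite muleC.
Qed.

Lemma Rintegral_swap_on b (f : sample * sample -> R) : bounded_measurable f ->
  \int[nu2]_p f (swap_on b p) = \int[nu2]_p f p.
Proof.
move=> bf; rewrite -(@Rintegral_distribution _ _ _ _ _ nu2 (swap_on b) f bf).
congr fine.
by apply: eq_measure_integral => A mA _; exact: swap_on_preserving.
Qed.

Lemma ae_swap_on b (Q : set (sample * sample)) :
  {ae nu2, forall p, Q p} -> {ae nu2, forall p, Q (swap_on b p)}.
Proof.
move=> [N [mN N0 QN]]; exists (swap_on b @^-1` N); split.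
- by rewrite -[X in measurable X]setTI; exact: measurable_swap_on.
- by rewrite swap_on_preserving.
- by move=> p /= Qp; apply: QN.
Qed.

Lemma Rintegral_fst (f : sample -> R) : bounded_measurable f ->
  \int[nu2]_p f p.1 = \int[nu]_x f x.
Proof.
move=> bf; rewrite Rintegral_product1; last exact: bounded_measurable_comp.
by apply: eq_Rintegral => x _ /=; rewrite Rintegral_bm_cst.
Qed.

(** [select b] is the first component of a swap, so a mixture of two independent samples has the law
    of one. *)
Lemma Rintegral_select b (f : sample -> R) : bounded_measurable f ->
  \int[nu2]_p f (select b p) = \int[nu]_x f x.
Proof.
move=> bf; rewrite -Rintegral_fst//.
rewrite -(@Rintegral_swap_on b (fun p => f p.1))//.
exact: bounded_measurable_comp.
Qed.

End IidSample.

(** * Moments under bounded differences *)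

(** Factoring out [a - b] leaves [2p + 1] products of total degree [m = 2p]. In absolute values [x],
    [y], each product plus its mirror image is at most [x ^+ m + y ^+ m], because [x ^+ i - y ^+ i]
    and [x ^+ j - y ^+ j] have the same sign; this pairing yields the factor 1/2. *)
Lemma ler_norm_subrXX_odd {R : realFieldType} (a b : R) (p : nat) :
  `|a ^+ (2 * p).+1 - b ^+ (2 * p).+1| <=
  `|a - b| * ((2 * p).+1%:R / 2 * (a ^+ (2 * p) + b ^+ (2 * p))).
Proof.
rewrite subrXX normrM ler_wpM2l//.
set m := (2 * p)%N.
have normm (x : R) : `|x| ^+ m = x ^+ m.
  by rewrite -normrX ger0_norm// /m exprM exprn_ge0// sqr_ge0.
rewrite -[a ^+ m]normm -[b ^+ m]normm.
set x := `|a|; set y := `|b|.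
have le1 : `|\sum_(i < m.+1) a ^+ (m.+1.-1 - i) * b ^+ i| <=
    \sum_(i < m.+1) x ^+ (m - i) * y ^+ i.
  apply: (le_trans (ler_norm_sum _ _ _)); apply: ler_sum => i _.
  by rewrite normrM !normrX.
apply: (le_trans le1).
have rev : \sum_(i < m.+1) x ^+ (m - i) * y ^+ i =
    \sum_(i < m.+1) x ^+ i * y ^+ (m - i).
  rewrite (reindex_inj rev_ord_inj)/=; apply: eq_bigr => i _.
  by rewrite subSS subKn// -ltnS.
have pair (i j : nat) : x ^+ i * y ^+ j + x ^+ j * y ^+ i <= x ^+ (i + j) + y ^+ (i + j).
  have : 0 <= (x ^+ i - y ^+ i) * (x ^+ j - y ^+ j).
    have [xy|/ltW yx] := leP x y.
      by apply: mulr_le0; rewrite subr_le0; apply: lerXn2r; rewrite ?nnegrE ?normr_ge0.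
    by apply: mulr_ge0; rewrite subr_ge0; apply: lerXn2r; rewrite ?nnegrE ?normr_ge0.
  by rewrite !exprD; nra.
have : \sum_(i < m.+1) (x ^+ (m - i) * y ^+ i + x ^+ i * y ^+ (m - i)) <=
    \sum_(i < m.+1) (x ^+ m + y ^+ m).
  apply: ler_sum => i _; have im : (i <= m)%N by rewrite -ltnS.
  by rewrite addrC; have := pair i (m - i)%N; rewrite subnKC.
rewrite big_split/= -rev sumr_const card_ord -mulr_natl.
set A := \sum_(i < _) _; set B := x ^+ m + _ => AB.
lra.
Qed.

Section MomentBound.
Context {d : measure_display} {S : measurableType d} {R : realType} {n : nat}.
Local Notation sample := (n.-tuple S).
Context (mu : set S -> \bar R) (nu : probability sample R).
Hypothesis hnu : iid_law mu nu.
Local Notation nu2 := (pairp nu nu).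

Definition resample (k : 'I_n) : sample * sample -> sample :=
  select (fun i => i != k).

Context (F : sample -> R) (c : R).
Hypotheses (bF : bounded_measurable F) (F0 : \int[nu]_x F x = 0).
Hypothesis Fc : forall k,
  {ae nu2, forall p, `|F p.1 - F (resample k p)| <= c}.

(* From the first sample (k = 0) to the second one (k = n). *)
Let interp (k : nat) : sample * sample -> sample := select (fun i => (k <= i)%N).

(** Up to a swap, which preserves the law, two consecutive hybrids are a sample and its resampling
    at [k]; this turns [Fc] into a bound on the increments. *)
Let interp_swap (k : 'I_n) p :
  interp k p = (swap_on (fun i => (k <= i)%N) p).1 /\
  interp k.+1 p = resample k (swap_on (fun i => (k <= i)%N) p).
Proof.
split=> //; apply: eq_from_tnth => i; rewrite !tnth_mktuple /=.
have [->|ik] := eqVneq i k; first by rewrite ltnn ?tnth_mktuple leqnn.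
by rewrite ?tnth_mktuple ltn_neqAle eq_sym ik.
Qed.

Let interp_resample (k : 'I_n) p :
  interp k (swap_on (fun i => i != k) p) = interp k.+1 p /\
  interp k.+1 (swap_on (fun i => i != k) p) = interp k p.
Proof.
split; apply: eq_from_tnth => i; rewrite !tnth_mktuple /=.
  have [->|ik] := eqVneq i k; first by rewrite leqnn ltnn.
  by rewrite [in RHS]ltn_neqAle eq_sym ik/=; case: ifP.
have [->|ik] := eqVneq i k; first by rewrite leqnn ltnn.
by rewrite [in LHS]ltn_neqAle eq_sym ik/=; case: ifP.
Qed.

Let bsel b : bounded_measurable (fun p => F (select b p)).
Proof. exact: (bounded_measurable_comp bF (@measurable_select _ _ _ b)). Qed.

Let bfst : bounded_measurable (fun p : sample * sample => F p.1).
Proof. exact: (bounded_measurable_comp bF measurable_fst). Qed.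

Let bsnd : bounded_measurable (fun p : sample * sample => F p.2).
Proof. exact: (bounded_measurable_comp bF measurable_snd). Qed.

(* Swapping coordinate k of the two samples exchanges interp k and interp k.+1 and
   turns z.1 into resample k z; averaging the two forms of the integral produces
   the second factor F z.1 ^+ q - F (resample k z) ^+ q. *)
Lemma increment_moment (k : 'I_n) (p : nat) :
  \int[nu2]_z ((F (interp k z) - F (interp k.+1 z)) * F z.1 ^+ (2 * p).+1) <=
  c ^+ 2 * (2 * p).+1%:R / 2 * \int[nu]_x F x ^+ (2 * p).
Proof.
set q := (2 * p).+1.
have bI j : bounded_measurable (fun z => F (interp j z)) by exact: bsel.
have bR : bounded_measurable (fun z => F (resample k z)) by exact: bsel.
have bA := bounded_measurableM (bounded_measurableB (bI k) (bI k.+1))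
  (bounded_measurableX q bfst).
have bB := bounded_measurableM (bounded_measurableB (bI k.+1) (bI k))
  (bounded_measurableX q bR).
set A := (X in X <= _).
have AE : A = \int[nu2]_z ((F (interp k.+1 z) - F (interp k z)) * F (resample k z) ^+ q).
  etransitivity; first exact: (esym (Rintegral_swap_on hnu (fun i => i != k) bA)).
  by apply: eq_Rintegral => z _ /=; rewrite !(interp_resample k z).1 (interp_resample k z).2.
suff : A + A <= c ^+ 2 * q%:R * \int[nu]_x F x ^+ (2 * p) by lra.
rewrite {2}AE -Rintegral_bmD//.
have E1 : \int[nu2]_z F z.1 ^+ (2 * p) = \int[nu]_x F x ^+ (2 * p).
  exact: (Rintegral_fst nu (bounded_measurableX (2 * p) bF)).
have E2 : \int[nu2]_z F (resample k z) ^+ (2 * p) = \int[nu]_x F x ^+ (2 * p).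
  exact: (Rintegral_select hnu _ (bounded_measurableX (2 * p) bF)).
have -> : c ^+ 2 * q%:R * \int[nu]_x F x ^+ (2 * p) =
    \int[nu2]_z (c ^+ 2 * q%:R / 2 * (F z.1 ^+ (2 * p) + F (resample k z) ^+ (2 * p))).
  have b1 := bounded_measurableX (2 * p) bfst.
  have b2 := bounded_measurableX (2 * p) bR.
  rewrite (Rintegral_bmZ nu2 _ (bounded_measurableD b1 b2)).
  by rewrite (Rintegral_bmD nu2 b1 b2) E1 E2; lra.
apply: ae_le_Rintegral.
- exact: bounded_measurableD.
- apply: bounded_measurableM; first exact: bounded_measurable_cst.
  by apply: bounded_measurableD; exact: bounded_measurableX.
have Fc' := ae_swap_on hnu (fun i : 'I_n => (k <= i)%N) (Fc k).
apply: filterS2 (Fc k) Fc' => z h1 h2.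
have {}h2 : `|F (interp k z) - F (interp k.+1 z)| <= c.
  by rewrite (interp_swap k z).1 (interp_swap k z).2.
set a := F z.1 in h1 *; set b := F (resample k z) in h1 *.
set e := F (interp k z) - _ in h2 *.
have -> : e * a ^+ q + (F (interp k.+1 z) - F (interp k z)) * b ^+ q =
    e * (a ^+ q - b ^+ q) by rewrite /e; ring.
apply: (le_trans (ler_norm _)); rewrite normrM.
(* One factor [c] bounds the increment [e]; the other will bound [a - b] in the difference of odd
   powers. *)
apply: (le_trans (ler_pM (normr_ge0 _) (normr_ge0 _) h2 (ler_norm_subrXX_odd a b p))).
have ab0 : 0 <= q%:R / 2 * (a ^+ (2 * p) + b ^+ (2 * p)).
  by rewrite mulr_ge0// addr_ge0// exprM exprn_ge0// sqr_ge0.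
have c0 : 0 <= c by exact: le_trans h1.
have := ler_wpM2l c0 (ler_wpM2r ab0 h1).
rewrite [X in _ <= X -> _](_ : _ = c ^+ 2 * q%:R / 2 * (a ^+ (2 * p) + b ^+ (2 * p))) //.
by ring.
Qed.

(** As [F] is centred and the two samples are independent, [F z.2 * F z.1 ^+ q] integrates to zero.
    One factor [F z.1] of the even power may thus be replaced by [F z.1 - F z.2], which telescopes
    along the hybrids into [n] increments. *)
Lemma even_moment_step (p : nat) :
  \int[nu]_x F x ^+ (2 * p.+1) <=
  n%:R * c ^+ 2 * (2 * p).+1%:R / 2 * \int[nu]_x F x ^+ (2 * p).
Proof.
set q := (2 * p).+1.
have bI j : bounded_measurable (fun z => F (interp j z)) by exact: bsel.
have bq := bounded_measurableX q bfst.
have bq1 := bounded_measurableX (2 * p.+1) bF.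
have bFF : bounded_measurable (fun z : sample * sample => F z.2 * F z.1 ^+ q).
  exact: bounded_measurableM.
have E0 : \int[nu2]_z (F z.2 * F z.1 ^+ q) = 0.
  rewrite Rintegral_product1//=.
  rewrite -[RHS](Rintegral_bm_cst nu); apply: eq_Rintegral => x _ /=.
  under eq_Rintegral do rewrite mulrC.
  by rewrite Rintegral_bmZ// F0 mulr0.
have -> : \int[nu]_x F x ^+ (2 * p.+1) =
    \int[nu2]_z (\sum_(k < n) (F (interp k z) - F (interp k.+1 z)) * F z.1 ^+ q).
  rewrite -[LHS]subr0 -[X in _ - X]E0 -(Rintegral_fst nu bq1).
  rewrite -Rintegral_bmB//; last exact: (bounded_measurable_comp bq1 measurable_fst).
  apply: eq_Rintegral => z _ /=.
  have i0 : interp 0 z = z.1.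
    by apply: eq_from_tnth => i; rewrite tnth_mktuple.
  have iN : interp n z = z.2.
    by apply: eq_from_tnth => i; rewrite tnth_mktuple leqNgt ltn_ord.
  rewrite -mulr_suml; transitivity ((F z.1 - F z.2) * F z.1 ^+ q).
    by rewrite mulnS/= addSn addSn add0n exprS; ring.
  congr (_ * _); rewrite -(big_mkord xpredT (fun k => F (interp k z) - F (interp k.+1 z))).
  rewrite (@telescope_sumr_eq _ 0 n (fun k => - F (interp k z)))//.
    by rewrite i0 iN; ring.
  by move=> k _; ring.
rewrite Rintegral_bm_sum; last first.
  by move=> k _; apply: bounded_measurableM => //; exact: bounded_measurableB.
apply: (le_trans (ler_sum _ (fun k _ => increment_moment k p))).
by rewrite sumr_const card_ord -[leLHS]mulr_natl !mulrA.
Qed.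

(** Induction, with [(2p + 1) / 2 <= p + 1] for the new factor and [p <= p + 1] inside the previous
    power. *)
Lemma even_moment_le (p : nat) :
  \int[nu]_x F x ^+ (2 * p) <= (p%:R * (n%:R * c ^+ 2)) ^+ p.
Proof.
set V := n%:R * c ^+ 2.
have V0 : 0 <= V by rewrite mulr_ge0// sqr_ge0.
elim: p => [|p IH].
  rewrite muln0 expr0 -[leRHS](Rintegral_bm_cst nu).
  by under eq_Rintegral do rewrite expr0.
apply: (le_trans (even_moment_step p)); rewrite -/V [leRHS]exprS.
apply: ler_pM.
- by rewrite divr_ge0// mulr_ge0.
- by apply: Rintegral_ge0 => x _; rewrite exprM exprn_ge0// sqr_ge0.
- have -> : ((2 * p).+1%:R : R) = 2 * p%:R + 1 by rewrite -addn1 natrD natrM.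
  have -> : (p.+1%:R : R) = p%:R + 1 by rewrite natr1.
  have aux (P x : R) : 0 <= x -> x * (2 * P + 1) / 2 <= (P + 1) * x by nra.
  exact: aux.
- apply: (le_trans IH); apply: lerXn2r.
  + by rewrite nnegrE mulr_ge0.
  + by rewrite nnegrE mulr_ge0.
  + by rewrite ler_wpM2r// ler_nat.
Qed.

(** Markov's inequality at order [2p]: the hypothesis makes the ratio of [p * n * c ^+ 2] to
    [t ^+ 2] at most [1 / e], and this ratio is raised to the power [p]. *)
Lemma moment_tail (p : nat) (t : R) : 0 < t ->
  expR 1 * (p%:R * (n%:R * c ^+ 2)) <= t ^+ 2 ->
  (nu [set x | (t <= F x)%R] <= (expR (- p%:R))%:E)%E.
Proof.
move=> t0 Vt; set A := [set x | _].
have mA : measurable A.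
  rewrite (_ : A = setT `&` F @^-1` `[t, +oo[%classic).
    by case: bF => mF _; apply: mF => //; exact: measurable_itv.
  by rewrite setTI; apply/seteqP; split => x /=; rewrite in_itv/= andbT.
rewrite -[X in (X <= _)%E]fineK ?fin_num_measure// lee_fin -Rintegral_indic//.
have tp0 : 0 < t ^+ (2 * p) by rewrite exprn_gt0.
rewrite -(ler_pM2r tp0).
have bI := bounded_measurable_indic (R := R) mA.
have -> : (\int[nu]_x \1_A x) * t ^+ (2 * p) = \int[nu]_x (t ^+ (2 * p) * \1_A x).
  by rewrite Rintegral_bmZ// mulrC.
apply: (@le_trans _ _ (\int[nu]_x F x ^+ (2 * p))).
  apply: le_Rintegral_bm.
  - by apply: bounded_measurableM => //; exact: bounded_measurable_cst.
  - exact: bounded_measurableX.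
  - move=> x; rewrite indicE; have [xA|_] := boolP (x \in A).
      have tF : t <= F x by move: xA; rewrite inE.
      by rewrite mulr1; apply: lerXn2r; rewrite ?nnegrE ?(ltW t0)// (le_trans (ltW t0)).
    by rewrite mulr0 exprM exprn_ge0// sqr_ge0.
apply: (le_trans (even_moment_le p)).
set V := p%:R * _ in Vt *.
have V0 : 0 <= V by rewrite mulr_ge0// mulr_ge0// sqr_ge0.
rewrite -mulrN1 expRM_natl exprM -exprMn; apply: lerXn2r.
- by rewrite nnegrE.
- by rewrite nnegrE mulr_ge0// ?expR_ge0// sqr_ge0.
- by rewrite expRN ler_pdivlMl// expR_gt0.
Qed.

End MomentBound.

(** * Envelopes of suprema, symmetrization and contraction *)

Section EnvelopeDifferences.
Context {d : measure_display} {S : measurableType d} {R : realType} {n : nat}.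
Local Notation sample := (n.-tuple S).
Context (mu : set S -> \bar R) (nu : probability sample R).
Hypothesis hnu : iid_law mu nu.
Local Notation nu2 := (pairp nu nu).

(** Resampling coordinate [k] after exchanging it restores the first sample, so swapping a one-sided
    almost sure bound gives the opposite side. *)
Lemma resample_swap_on (k : 'I_n) (p : sample * sample) :
  resample k (swap_on (fun i => i != k) p) = p.1.
Proof. by apply: eq_from_tnth => i; rewrite !tnth_mktuple/= ?tnth_mktuple; case: eqP. Qed.

(* For each fixed y, H (resample k (x, y)) + c is a measurable majorant of Z, so it
   dominates the minimal majorant H almost everywhere. *)
Lemma envelope_differences (Z : sample -> \bar R) (H : sample -> R) (c : R) :
  (forall x, 0 <= Z x)%E ->
  bounded_measurable H -> ((\int[nu]_x H x)%:E <= outer_integral nu Z)%E ->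
  (forall x, (Z x <= (H x)%:E)%E) ->
  (forall k x y, Z x <= Z (resample k (x, y)) + c%:E)%E ->
  forall k, {ae nu2, forall p, `|H p.1 - H (resample k p)| <= c}.
Proof.
move=> Z0 bH Hmin ZH Zc k.
have bR : bounded_measurable (fun p => H (resample k p)).
  exact: (bounded_measurable_comp bH (@measurable_select _ _ _ _)).
have b1 : bounded_measurable (fun p : sample * sample => H p.1).
  exact: (bounded_measurable_comp bH measurable_fst).
pose A := [set p : sample * sample | H (resample k p) + c < H p.1].
have mA : measurable A.
  rewrite (_ : A = setT `&` (fun p => H p.1 - H (resample k p)) @^-1` `]c, +oo[%classic).
    by have [mD _] := bounded_measurableB b1 bR; apply: mD => //; exact: measurable_itv.
  rewrite setTI; apply/seteqP; split => p /=; rewrite in_itv/= andbT.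
    by rewrite ltrBrDl.
  by rewrite ltrBrDl.
have A0 : nu2 A = 0%E.
  rewrite -[LHS]fineK ?fin_num_measure//; congr EFin.
  rewrite -Rintegral_indic// Rintegral_product2; last exact: bounded_measurable_indic.
  rewrite -[RHS](Rintegral_bm_cst nu); apply: eq_Rintegral => y _.
  have bAy : bounded_measurable (fun x => \1_A (x, y) : R).
    apply: (bounded_measurable_comp (bounded_measurable_indic mA)).
    exact: pair2_measurable.
  apply/eqP; rewrite eq_le; apply/andP; split; last exact: Rintegral_ge0.
  rewrite -[leRHS](Rintegral_bm_cst nu).
  apply: ae_le_Rintegral => //; first exact: bounded_measurable_cst.
  have mG : measurable_fun setT (fun x => H (resample k (x, y)) + c).
    apply: measurable_funD; last exact: measurable_cst.
    have [mR _] := bR.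
    exact: (measurableT_comp mR (pair2_measurable y)).
  have := envelope_minimal (m := nu) Z0 bH Hmin ZH mG.
  have ZG x : (Z x <= (H (resample k (x, y)) + c)%:E)%E.
    by rewrite (le_trans (Zc k x y))// EFinD leeD2r.
  move=> /(_ ZG); apply: filterS => x Hx.
  by rewrite indicE memNset//= => hlt; move: Hx; rewrite leNgt hlt.
have h1 : {ae nu2, forall p, H p.1 <= H (resample k p) + c}.
  exists A; split => // p /= /negP; by rewrite -ltNge.
have h2 := ae_swap_on hnu (fun i => i != k) h1.
apply: filterS2 h1 h2 => p h1 /=; rewrite resample_swap_on => h2.
by rewrite ler_norml; rewrite -/(resample k p) in h2; apply/andP; split; lra.
Qed.

Lemma envelope_tail (Z : sample -> \bar R) (H : sample -> R) (c t : R) (p : nat) :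
  (forall x, 0 <= Z x)%E ->
  bounded_measurable H -> ((\int[nu]_x H x)%:E <= outer_integral nu Z)%E ->
  (forall x, (Z x <= (H x)%:E)%E) ->
  (forall k x y, Z x <= Z (resample k (x, y)) + c%:E)%E ->
  0 < t -> expR 1 * (p%:R * (n%:R * c ^+ 2)) <= t ^+ 2 ->
  (nu [set x | (\int[nu]_x H x + t <= H x)%R] <= (expR (- p%:R))%:E)%E.
Proof.
move=> Z0 bH Hmin ZH Zc t0 Vt; set e := \int[nu]_x H x.
have bc := @bounded_measurable_cst _ _ _ e : bounded_measurable (fun _ : sample => e).
have bF := bounded_measurableB bH bc.
have F0 : \int[nu]_x (H x - e) = 0.
  by rewrite (Rintegral_bmB nu bH bc) Rintegral_bm_cst subrr.
have dF k : {ae nu2, forall p, `|(H p.1 - e) - (H (resample k p) - e)| <= c}.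
  apply: filterS (envelope_differences Z0 bH Hmin ZH Zc k) => q.
  by rewrite (_ : H q.1 - e - _ = H q.1 - H (resample k q)); last by ring.
have := moment_tail hnu bF F0 dF t0 Vt.
rewrite (_ : [set x | e + t <= H x] = [set x | t <= H x - e])//.
by apply/seteqP; split => x /=; rewrite lerBrDl.
Qed.

End EnvelopeDifferences.

Lemma measurable_tuple_map {d d' : measure_display} {S : measurableType d}
  {T : measurableType d'} {n : nat} (X : S -> T) : measurable_fun setT X ->
  measurable_fun setT (fun x : n.-tuple S => [tuple X (tnth x i) | i < n]).
Proof.
move=> mX; apply/measurable_fun_tnthP => i.
rewrite (_ : _ \o _ = X \o (fun x => tnth x i)).
  exact: (measurableT_comp mX (measurable_tnth i)).
by apply/funext => x /=; rewrite tnth_mktuple.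
Qed.

(** * One-sided symmetrization and contraction for bounded multipliers *)

Section Symmetrization.
Context {d : measure_display} {S : measurableType d} {R : realType} {n : nat}.
Local Notation sample := (n.-tuple S).
Context (mu : set S -> \bar R) (nu : probability sample R).
Hypothesis hnu : iid_law mu nu.
Local Notation nu2 := (pairp nu nu).
Local Notation signs := {ffun 'I_n -> bool}.

Definition sample_mean (phi : S -> R) (x : sample) : R :=
  n%:R^-1 * \sum_(i < n) phi (tnth x i).

Lemma bounded_measurable_tnth (phi : S -> R) (i : 'I_n) : bounded_measurable phi ->
  bounded_measurable (fun x : sample => phi (tnth x i)).
Proof. by move=> bphi; exact: (bounded_measurable_comp bphi (measurable_tnth i)). Qed.

Lemma bounded_measurable_sample_mean (phi : S -> R) : bounded_measurable phi ->
  bounded_measurable (sample_mean phi).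
Proof.
move=> bphi; apply: bounded_measurableM; first exact: bounded_measurable_cst.
by apply: bounded_measurable_sum => i _; exact: bounded_measurable_tnth.
Qed.

Lemma sample_meanB (f g : S -> R) (x : sample) :
  sample_mean (fun s => f s - g s) x = sample_mean f x - sample_mean g x.
Proof. by rewrite /sample_mean -mulrBr -sumrB. Qed.

Lemma sample_mean_sum (I : Type) (s : seq I) (Q : pred I) (b : R) (f : I -> S -> R)
    (x : sample) :
  sample_mean (fun y => \sum_(i <- s | Q i) b * f i y) x =
  \sum_(i <- s | Q i) b * sample_mean (f i) x.
Proof.
rewrite /sample_mean exchange_big/= mulr_sumr; apply: eq_bigr => i _.
by rewrite -mulr_sumr mulrCA.
Qed.

Lemma card_signs : #|{: signs}| = (2 ^ n)%N.
Proof. by rewrite card_ffun card_bool card_ord. Qed.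

(** For every [eps], the difference of the sample means at [x] and at an independent copy [y] is a
    signed mean over one mixture of the two minus the signed mean over the complementary mixture.
    [D] averages the resulting bounds over [eps] and [G] integrates [y] out; both mixtures have law
    [nu], whence the factor 2. *)
Lemma symmetrization (Phi : set (S -> R)) (Q : signs -> sample -> R) :
  (forall phi, Phi phi -> bounded_measurable phi) ->
  (forall eps, bounded_measurable (Q eps)) ->
  (forall (eps : signs) phi x, Phi phi ->
    `|n%:R^-1 * \sum_(i < n) (-1) ^+ eps i * phi (tnth x i)| <= Q eps x) ->
  exists G : sample -> R, [/\ bounded_measurable G,
    forall phi x, Phi phi ->
      sample_mean phi x - \int[nu]_y sample_mean phi y <= G x &
    \int[nu]_x G x = 2 * ((2 ^+ n)^-1 * \sum_eps \int[nu]_x Q eps x)].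
Proof.
move=> bPhi bQ QPhi.
pose D (p : sample * sample) : R := (2 ^+ n)^-1 * \sum_(eps : signs)
  (Q eps (select (fun i => ~~ eps i) p) + Q eps (select eps p)).
have bs (eps : signs) b : bounded_measurable (fun p => Q eps (select b p)).
  exact: (bounded_measurable_comp (bQ eps) (@measurable_select _ _ _ b)).
have bsum : bounded_measurable (fun p => \sum_(eps : signs)
    (Q eps (select (fun i => ~~ eps i) p) + Q eps (select eps p))).
  by apply: bounded_measurable_sum => eps _; exact: bounded_measurableD.
have bD : bounded_measurable D.
  by apply: bounded_measurableM => //; exact: bounded_measurable_cst.
exists (fun x => \int[nu]_y D (x, y)); split.
- exact: bounded_measurable_Rintegral.
- move=> phi x Pphi.
  have bphi := bounded_measurable_sample_mean (bPhi _ Pphi).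
  rewrite -[X in X - _](Rintegral_bm_cst nu) -Rintegral_bmB//; last exact: bounded_measurable_cst.
  apply: le_Rintegral_bm.
  + by apply: bounded_measurableB => //; exact: bounded_measurable_cst.
  + exact: (bounded_measurable_comp bD (pair1_measurable x)).
  move=> y; rewrite /D.
  set L := sample_mean phi x - sample_mean phi y.
  have -> : L = (2 ^+ n)^-1 * \sum_(eps : signs) L.
    by rewrite sumr_const card_signs -(mulr_natl L) mulrA natrX mulVf ?mul1r // expf_neq0.
  rewrite ler_wpM2l ?invr_ge0 ?exprn_ge0//; apply: ler_sum => eps _.
  have LE : L = n%:R^-1 * (\sum_(i < n) (-1) ^+ eps i * phi (tnth (select (fun i => ~~ eps i) (x, y)) i))
      - n%:R^-1 * (\sum_(i < n) (-1) ^+ eps i * phi (tnth (select eps (x, y)) i)).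
    rewrite /L /sample_mean -!mulrBr -!sumrB; congr (_ * _); apply: eq_bigr => i _.
    by rewrite !tnth_mktuple /=; case: (eps i) => /=; rewrite ?expr0 ?expr1; ring.
  rewrite LE; apply: (le_trans (ler_norm _)); apply: (le_trans (ler_normB _ _)).
  by apply: lerD; exact: QPhi.
- rewrite -Rintegral_product1// /D (Rintegral_bmZ _ _ bsum).
  rewrite mulrCA; congr (_ * _); rewrite Rintegral_bm_sum; last first.
    by move=> eps _; exact: bounded_measurableD.
  rewrite mulr_sumr; apply: eq_bigr => eps _.
  rewrite Rintegral_bmD//.
  rewrite [X in X + _](Rintegral_select hnu _ (bQ eps)).
  by rewrite [X in _ + X](Rintegral_select hnu _ (bQ eps)) mulr2n mulrDl mul1r.
Qed.

Lemma sum_signs_prod (F : 'I_n -> bool -> R) :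
  \sum_(eps : signs) \prod_(i < n) F i (eps i) =
  \prod_(i < n) (F i false + F i true).
Proof.
rewrite -(bigA_distr_bigA (fun i b => F i b)) /=.
by apply: eq_bigr => i _; rewrite big_bool/= addrC.
Qed.

(* A point h of the cube [-1, 1]^n is the barycenter of the vertices
   ((-1) ^+ sigma i)_i with these weights. *)
Definition vertex_weight (h : 'I_n -> R) (sigma : signs) : R :=
  \prod_(i < n) ((1 + (-1) ^+ sigma i * h i) / 2).

Lemma vertex_weight_ge0 (h : 'I_n -> R) sigma : (forall i, `|h i| <= 1) ->
  0 <= vertex_weight h sigma.
Proof.
move=> h1; apply: prodr_ge0 => i _; rewrite divr_ge0//.
by have := h1 i; rewrite ler_norml => /andP[]; case: (sigma i); rewrite ?expr1 ?expr0; lra.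
Qed.

(** The sum over sign vectors factorizes: factor [i] contributes [h i] and every other factor 1. *)
Lemma vertex_combination (h : 'I_n -> R) (i : 'I_n) :
  \sum_(sigma : signs) vertex_weight h sigma * (-1) ^+ sigma i = h i.
Proof.
pose F j (b : bool) := (1 + (-1) ^+ b * h j) / 2 * (if j == i then (-1) ^+ b else 1).
transitivity (\sum_(sigma : signs) \prod_(j < n) F j (sigma j)).
  apply: eq_bigr => sigma _; rewrite big_split/=; congr (_ * _).
  by rewrite -big_mkcond/= big_pred1_eq.
rewrite sum_signs_prod (bigD1 i)//= [X in _ * X]big1 ?mulr1.
  by rewrite /F eqxx expr0 expr1; field.
by move=> j /negbTE ji; rewrite /F ji expr0 expr1; field.
Qed.

(** In each factor the terms for [h i] and [- h i] add up to 1, so under random signs every vertex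
    gets the same total weight, whatever [h] is. *)
Lemma sum_vertex_weight_signs (h : 'I_n -> R) (sigma : signs) :
  \sum_(eps : signs) vertex_weight (fun i => (-1) ^+ eps i * h i) sigma = 1.
Proof.
rewrite (sum_signs_prod (fun i b => (1 + (-1) ^+ sigma i * ((-1) ^+ b * h i)) / 2)).
by apply: big1 => i _; rewrite expr0 expr1; field.
Qed.

(** The triangle inequality, applied to [h] written as a convex combination of sign vectors. *)
Lemma contraction (h t : 'I_n -> R) (M : signs -> R) :
  (forall i, `|h i| <= 1) ->
  (forall sigma : signs, `|n%:R^-1 * \sum_(i < n) (-1) ^+ sigma i * t i| <= M sigma) ->
  `|n%:R^-1 * \sum_(i < n) h i * t i| <= \sum_sigma vertex_weight h sigma * M sigma.
Proof.
move=> h1 tM.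
have -> : n%:R^-1 * \sum_(i < n) h i * t i = \sum_(sigma : signs)
    vertex_weight h sigma * (n%:R^-1 * \sum_(i < n) (-1) ^+ sigma i * t i).
  transitivity (n%:R^-1 * \sum_(i < n) \sum_(sigma : signs) vertex_weight h sigma * (-1) ^+ sigma i * t i).
    by congr (_ * _); apply: eq_bigr => i _; rewrite -mulr_suml vertex_combination.
  rewrite exchange_big/= mulr_sumr; apply: eq_bigr => sigma _.
  rewrite mulrCA; congr (_ * _); rewrite mulr_sumr.
  by apply: eq_bigr => i _; rewrite mulrA.
apply: (le_trans (ler_norm_sum _ _ _)); apply: ler_sum => sigma _.
rewrite normrM (ger0_norm (vertex_weight_ge0 _ h1)).
by apply: ler_wpM2l => //; exact: vertex_weight_ge0.
Qed.

Context {d' : measure_display} {T : measurableType d'} (X : S -> T).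

(** Contraction at the point with coordinates [(-1) ^+ eps i * h (tnth x i)] provides the bounds
    [Q eps] for symmetrization. Summed over [eps], the vertex weights add up to 1, so [h] disappears
    from the integral at no cost in the constant. *)
Lemma weighted_symmetrization (h : S -> R) (Gam : set (T -> R))
    (M : signs -> n.-tuple T -> R) :
  measurable_fun setT X -> measurable_fun setT h -> (forall s, `|h s| <= 1) ->
  (forall g, Gam g -> bounded_measurable g) ->
  (forall sigma, bounded_measurable (M sigma)) ->
  (forall (sigma : signs) g x, Gam g ->
    `|n%:R^-1 * \sum_(i < n) (-1) ^+ sigma i * g (tnth x i)| <= M sigma x) ->
  exists G : sample -> R, [/\ bounded_measurable G,
    forall g x, Gam g -> sample_mean (fun s => h s * g (X s)) x -
       \int[nu]_y sample_mean (fun s => h s * g (X s)) y <= G x &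
    \int[nu]_x G x = 2 * ((2 ^+ n)^-1 *
       \sum_sigma \int[nu]_x M sigma [tuple X (tnth x i) | i < n])].
Proof.
move=> mX mh h1 bGam bM MGam.
pose Xn (x : sample) : n.-tuple T := [tuple X (tnth x i) | i < n].
have mXn : measurable_fun setT Xn by exact: measurable_tuple_map.
have bh : bounded_measurable h by split => //; exists 1.
pose W (eps sigma : signs) (x : sample) :=
  vertex_weight (fun i => (-1) ^+ eps i * h (tnth x i)) sigma.
pose Q (eps : signs) (x : sample) := \sum_(sigma : signs) W eps sigma x * M sigma (Xn x).
have bW eps sigma : bounded_measurable (W eps sigma).
  apply: bounded_measurable_prod => i _.
  apply: bounded_measurableM; last exact: bounded_measurable_cst.
  apply: bounded_measurableD; first exact: bounded_measurable_cst.
  apply: bounded_measurableM; first exact: bounded_measurable_cst.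
  apply: bounded_measurableM; first exact: bounded_measurable_cst.
  exact: bounded_measurable_tnth.
have bMX sigma : bounded_measurable (fun x => M sigma (Xn x)).
  exact: (bounded_measurable_comp (bM sigma) mXn).
have bWM eps sigma : bounded_measurable (fun x => W eps sigma x * M sigma (Xn x)).
  exact: bounded_measurableM.
have bQ eps : bounded_measurable (Q eps).
  by apply: bounded_measurable_sum => sigma _.
pose Phi := [set phi : S -> R | exists2 g, Gam g & phi = (fun s => h s * g (X s))].
have bPhi phi : Phi phi -> bounded_measurable phi.
  move=> [g /bGam bg ->]; apply: bounded_measurableM => //.
  exact: (bounded_measurable_comp bg mX).
have QPhi (eps : signs) phi x : Phi phi ->
    `|n%:R^-1 * \sum_(i < n) (-1) ^+ eps i * phi (tnth x i)| <= Q eps x.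
  move=> [g Gg ->].
  have := @contraction (fun i => (-1) ^+ eps i * h (tnth x i)) (fun i => g (X (tnth x i)))
    (fun sigma => M sigma (Xn x)).
  have -> : \sum_(i < n) (-1) ^+ eps i * h (tnth x i) * g (X (tnth x i)) =
      \sum_(i < n) (-1) ^+ eps i * (h (tnth x i) * g (X (tnth x i))).
    by apply: eq_bigr => i _; rewrite mulrA.
  apply; first by move=> i; rewrite normrMsign.
  move=> sigma; have := MGam sigma g (Xn x) Gg.
  have -> // : \sum_(i < n) (-1) ^+ sigma i * g (tnth (Xn x) i) =
      \sum_(i < n) (-1) ^+ sigma i * g (X (tnth x i)).
  by apply: eq_bigr => i _; rewrite tnth_mktuple.
have [G [bG GPhi GE]] := symmetrization bPhi bQ QPhi.
exists G; split => //; first by move=> g x Gg; apply: GPhi; exists g.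
rewrite GE; congr (_ * (_ * _)).
rewrite -!Rintegral_bm_sum//; apply: eq_Rintegral => x _.
rewrite /Q exchange_big/=; apply: eq_bigr => sigma _.
by rewrite -mulr_suml sum_vertex_weight_signs mul1r.
Qed.

End Symmetrization.

(** * Uniform deviations *)

Section UniformDeviation.
Context {d : measure_display} {S : measurableType d} {R : realType} {n : nat}.
Local Notation sample := (n.-tuple S).
Context (mu : set S -> \bar R) (nu : probability sample R).
Hypotheses (hnu : iid_law mu nu) (n0 : (0 < n)%N).

Lemma ler_norm_sample_mean (f : S -> R) (b : R) (x : sample) :
  (forall s, `|f s| <= b) -> `|sample_mean f x| <= b.
Proof.
move=> fb; rewrite /sample_mean normrM ger0_norm ?invr_ge0//.
rewrite ler_pdivrMl ?ltr0n//; apply: (le_trans (ler_norm_sum _ _ _)).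
apply: (le_trans (ler_sum _ (fun i _ => fb (tnth x i)))).
by rewrite sumr_const card_ord -(mulr_natl b).
Qed.

Lemma sample_mean_resample (f : S -> R) (b : R) (k : 'I_n) (x y : sample) :
  (forall s, `|f s| <= b) ->
  sample_mean f (resample k (x, y)) - sample_mean f x <= 2 * b / n%:R.
Proof.
move=> fb; rewrite /sample_mean -mulrBr -sumrB (bigD1 k)//= [X in _ + X]big1.
  rewrite addr0 tnth_mktuple/= eqxx/= mulrC ler_wpM2r ?invr_ge0//.
  have := fb (tnth y k); have := fb (tnth x k).
  by rewrite !ler_norml => /andP[? ?] /andP[? ?]; lra.
by move=> i ik; rewrite tnth_mktuple ik subrr.
Qed.

(** Concentration concerns the envelope [H] of the supremum [Z]; the function [G], a measurable
    majorant of [Z], serves to bound the mean of [H]. *)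
Lemma uniform_deviation (Psi : set (S -> R)) (b t : R) (p : nat) (G : sample -> R) :
  (forall f, Psi f -> bounded_measurable f /\ forall s, `|f s| <= b) ->
  Psi (fun=> 0) -> bounded_measurable G ->
  (forall f x, Psi f -> \int[nu]_y sample_mean f y - sample_mean f x <= G x) ->
  0 < t -> expR 1 * (p%:R * (n%:R * (2 * b / n%:R) ^+ 2)) <= t ^+ 2 ->
  exists E : set sample, [/\ measurable E,
    ((1 - expR (- p%:R))%:E <= nu E)%E &
    forall x f, E x -> Psi f ->
      \int[nu]_y sample_mean f y - sample_mean f x <= \int[nu]_y G y + t].
Proof.
move=> bPsi Psi0 bG PsiG t0 pt.
pose Dv (f : S -> R) (x : sample) := \int[nu]_y sample_mean f y - sample_mean f x.
pose Z (x : sample) := ereal_sup [set (Dv f x)%:E | f in Psi].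
have bmean f : Psi f -> bounded_measurable (sample_mean f : sample -> R).
  by move=> /bPsi[bf _]; exact: bounded_measurable_sample_mean.
have ZP x f : Psi f -> ((Dv f x)%:E <= Z x)%E.
  by move=> Pf; apply: ereal_sup_ubound; exists f.
(* The zero function in [Psi] makes the supremum nonnegative, as envelopes require. *)
have Z0 x : (0 <= Z x)%E.
  apply: (le_trans _ (ZP x _ Psi0)); rewrite lee_fin /Dv.
  have m0 (y : sample) : sample_mean (fun=> 0) y = 0 :> R.
    by rewrite /sample_mean big1 ?mulr0.
  by rewrite m0 subr0; apply: Rintegral_ge0 => y _; rewrite m0.
have ZB x : (Z x <= (2 * b)%:E)%E.
  apply: ge_ereal_sup => _ [f Pf <-]; rewrite lee_fin /Dv.
  have fb := (bPsi f Pf).2.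
  have := ler_norm_sample_mean x fb.
  have : `|\int[nu]_y sample_mean f y| <= b.
    apply: (le_trans (le_normr_Rintegral _ _)) => //.
      exact: (bounded_measurable_integrable nu (bmean f Pf)).
    rewrite -[leRHS](Rintegral_bm_cst nu); apply: le_Rintegral_bm.
    - exact: (bounded_measurable_norm (bmean f Pf)).
    - exact: bounded_measurable_cst.
    - by move=> y; exact: ler_norm_sample_mean.
  by rewrite !ler_norml => /andP[? ?] /andP[? ?]; lra.
(* Changing one coordinate moves each sample mean by at most [2 * b / n], a bound uniform in [f]
   that passes to the supremum. *)
have Zc k x y : (Z x <= Z (resample k (x, y)) + (2 * b / n%:R)%:E)%E.
  apply: ge_ereal_sup => _ [f Pf <-].
  apply: (@le_trans _ _ ((Dv f (resample k (x, y)))%:E + (2 * b / n%:R)%:E)%E).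
    rewrite -EFinD lee_fin /Dv.
    have := sample_mean_resample k x y (bPsi f Pf).2; lra.
  by apply: leeD2r; exact: ZP.
have Z0B x : (0 <= Z x <= (2 * b)%:E)%E by rewrite Z0 ZB.
have [H [bH ZH HB Hmin]] := outer_integral_attained nu Z0B.
have := envelope_tail hnu Z0 bH Hmin ZH Zc t0 pt.
set A := [set x | _] => nuA.
have mA : measurable A.
  rewrite (_ : A = setT `&` H @^-1` `[\int[nu]_x H x + t, +oo[%classic).
    by case: bH => mH _; apply: mH => //; exact: measurable_itv.
  by rewrite setTI; apply/seteqP; split => x /=; rewrite in_itv/= andbT.
exists (~` A); split; first exact: measurableC.
  rewrite probability_setC// EFinB; apply: leeB => //.
move=> x f /negP; rewrite -ltNge => Hx Pf.
have HG : \int[nu]_x H x <= \int[nu]_x G x.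
  rewrite -lee_fin (le_trans Hmin)// -Rintegral_bm_fin//.
  apply: ereal_inf_lbound; exists (fun x => (G x)%:E) => //; split.
    by apply/measurable_EFinP; have [] := bG.
  by move=> y; apply: ge_ereal_sup => _ [g Pg <-]; rewrite lee_fin; exact: PsiG.
have := le_trans (ZP x f Pf) (ZH x); rewrite lee_fin /Dv; lra.
Qed.

End UniformDeviation.

(** * Scores and Rademacher complexities *)

Section Score.
Context {d' : measure_display} {T : measurableType d'} {R : realType} {K : nat}.
Context (u : bool -> 'I_K -> R) (pit : T -> 'I_K) (m : 'I_K -> T -> R).
Local Notation unit_type := (K.-tuple bool * T)%type.
Local Notation C := (utility_bound u).

Definition arm_payoff (a : 'I_K) (s : unit_type) : R :=
  utility_gain u a *
    (policy_ind pit a s.2 * (observed_outcome pit s)%:R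
     + (1 - policy_ind pit a s.2) * m a s.2)
  + utility_cost u a.

Lemma sum_policy_ind (pi : T -> 'I_K) (x : T) (f : 'I_K -> R) :
  \sum_(a < K) policy_ind pi a x * f a = f (pi x).
Proof.
rewrite (bigD1 (pi x))//= big1 ?addr0 /policy_ind ?eqxx ?mul1r//.
by move=> a /negbTE ax; rewrite eq_sym ax mul0r.
Qed.

Lemma scoreE (pi : T -> 'I_K) (s : unit_type) :
  score u pit pi m s = arm_payoff (pi s.2) s.
Proof. exact: (sum_policy_ind pi s.2 (fun a => arm_payoff a s)). Qed.

(** The indicators of the actions sum to 1, so the reference action can be eliminated; the [K - 1]
    remaining indicators are the source of the factor [K - 1]. *)
Lemma score_contrast (a0 : 'I_K) (pi : T -> 'I_K) (s : unit_type) :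
  score u pit pi m s = arm_payoff a0 s +
    \sum_(a < K | a != a0) (arm_payoff a s - arm_payoff a0 s) * policy_ind pi a s.2.
Proof.
have := sum_policy_ind pi s.2 (fun a => arm_payoff a s - arm_payoff a0 s).
rewrite (bigD1 a0)//= subrr mulr0 add0r scoreE => E.
under eq_bigr do rewrite mulrC.
by rewrite E addrC subrK.
Qed.

Lemma utility_bound_ge (y : bool) (a : 'I_K) : `|u y a| <= C.
Proof.
apply: (le_trans (le_bigmax _ (fun a => `|u y a|) a)).
exact: (le_bigmax _ (fun y => \big[Num.max/0]_(a < K) `|u y a|) y).
Qed.

Lemma utility_bound_ge0 : 0 <= C.
Proof. by rewrite /utility_bound; elim/big_rec: _ => // y x _ x0; rewrite le_max x0 orbT. Qed.

Hypothesis m01 : forall a x, 0 <= m a x <= 1.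

(** The payoff is the convex combination [v * u true a + (1 - v) * u false a], where [v] is the
    observed outcome if [a] is the baseline action and the model value otherwise. *)
Lemma norm_arm_payoff (a : 'I_K) (s : unit_type) : `|arm_payoff a s| <= C.
Proof.
have := utility_bound_ge true a; have := utility_bound_ge false a.
rewrite /arm_payoff /utility_gain /utility_cost !ler_norml.
move=> /andP[a1 a2] /andP[b1 b2].
set v := _ * _%:R + _.
have /andP[v0 v1] : 0 <= v <= 1.
  rewrite /v /policy_ind; case: eqP => _.
    by rewrite subrr mul0r addr0 mul1r; case: (observed_outcome _ _); rewrite /= ?ler01 ?lexx.
  by rewrite mul0r add0r subr0 mul1r.
by apply/andP; split; nra.
Qed.

Lemma norm_score (pi : T -> 'I_K) (s : unit_type) : `|score u pit pi m s| <= C.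
Proof. by rewrite scoreE; exact: norm_arm_payoff. Qed.

Hypothesis mm : forall a, measurable_fun setT (m a).
Hypothesis mpit : measurable_policy pit.

Lemma bounded_measurable_policy_ind (pi : T -> 'I_K) (a : 'I_K) :
  measurable_policy pi -> bounded_measurable (policy_ind pi a : T -> R).
Proof.
move=> mpi; apply: (eq_bounded_measurable (bounded_measurable_indic (mpi a))) => x.
rewrite indicE /policy_ind; congr (_%:R).
by case: eqP => [xa|xa]; [rewrite mem_set|rewrite memNset].
Qed.

Lemma bounded_measurable_arm_payoff (a : 'I_K) : bounded_measurable (arm_payoff a).
Proof.
have mtn (b : 'I_K) : bounded_measurable (fun s : unit_type => (tnth s.1 b)%:R : R).
  apply: (@bounded_measurable_comp _ _ _ _ _ (fun y : bool => y%:R : R) (fun s : unit_type => tnth s.1 b)).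
    by split => //; exists 1 => -[]; rewrite ?normr1 ?normr0.
  exact: (measurableT_comp (measurable_tnth b) measurable_fst).
have bind (b : 'I_K) : bounded_measurable (fun s : unit_type => policy_ind pit b s.2 : R).
  by apply: bounded_measurable_comp => //; exact: bounded_measurable_policy_ind.
(* The lookup at an index depending on the covariate is rewritten as a finite sum over the actions,
   whose terms are visibly measurable. *)
have bY : bounded_measurable (fun s : unit_type => (observed_outcome pit s)%:R : R).
  apply: (@eq_bounded_measurable _ _ _ (fun s : unit_type =>
      \sum_(b < K) policy_ind pit b s.2 * (tnth s.1 b)%:R)).
    by apply: bounded_measurable_sum => b _; exact: bounded_measurableM.
  by move=> s; rewrite (sum_policy_ind pit s.2 (fun b => (tnth s.1 b)%:R)).
have bm : bounded_measurable (fun s : unit_type => m a s.2).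
  apply: (@bounded_measurable_comp _ _ _ _ _ (m a)) => //.
  by split => //; exists 1 => x; have /andP[? ?] := m01 a x; rewrite ger0_norm.
have bcst r := @bounded_measurable_cst _ unit_type R r.
apply: bounded_measurableD => //; apply: bounded_measurableM => //.
apply: bounded_measurableD; apply: bounded_measurableM => //.
exact: bounded_measurableB.
Qed.

Lemma bounded_measurable_score (pi : T -> 'I_K) : measurable_policy pi ->
  bounded_measurable (score u pit pi m).
Proof.
move=> mpi; apply: bounded_measurable_sum => a _; apply: bounded_measurableM.
  by apply: bounded_measurable_comp => //; exact: bounded_measurable_policy_ind.
exact: bounded_measurable_arm_payoff.
Qed.

End Score.

Section RademacherEnvelope.
Context {d d' : measure_display} {Omega : measurableType d}
  {T : measurableType d'} {R : realType} (P : probability Omega R) (n : nat).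
Local Notation signs := {ffun 'I_n -> bool}.

(** Each sign vector gets its own envelope under the law of the covariates. As the envelopes attain
    the outer integrals, using them in place of the suprema does not exceed the complexity. *)
Lemma rademacher_envelope (X : 'I_n -> Omega -> T) (Gam : set (T -> R)) (b : R) :
  (0 < n)%N -> (forall i, measurable_fun setT (X i)) -> Gam !=set0 ->
  (forall g, Gam g -> forall x, `|g x| <= b) ->
  exists M : signs -> n.-tuple T -> R, [/\ forall sigma, bounded_measurable (M sigma),
    forall (sigma : signs) g x, Gam g ->
      `|n%:R^-1 * \sum_(i < n) (-1) ^+ sigma i * g (tnth x i)| <= M sigma x &
    (((2 ^+ n)^-1 * \sum_sigma \int[P]_w M sigma [tuple X i w | i < n])%:E
      <= rademacher P X Gam)%E].
Proof.
move=> n0 mX [g0 Gg0] Gb.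
pose Xn (w : Omega) : n.-tuple T := [tuple X i w | i < n].
have mXn : measurable_fun setT Xn.
  apply/measurable_fun_tnthP => i.
  rewrite (_ : _ \o _ = X i)//.
  by apply/funext => w /=; rewrite tnth_mktuple.
pose XnM : {mfun Omega >-> n.-tuple T} := HB.pack Xn (isMeasurableFun.Build _ _ _ _ Xn mXn).
pose Z (sigma : signs) (x : n.-tuple T) : \bar R := ereal_sup
  [set `| n%:R^-1 * \sum_(i < n) (-1) ^+ sigma i * g (tnth x i) |%:E | g in Gam].
have ZP (sigma : signs) x g : Gam g ->
    ((`|n%:R^-1 * \sum_(i < n) (-1) ^+ sigma i * g (tnth x i)|)%:E <= Z sigma x)%E.
  by move=> Gg; apply: ereal_sup_ubound; exists g.
have ZB (sigma : signs) x : (0 <= Z sigma x <= b%:E)%E.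
  rewrite (le_trans _ (ZP sigma x _ Gg0)) ?lee_fin//=.
  apply: ge_ereal_sup => _ [g Gg <-]; rewrite lee_fin normrM ger0_norm ?invr_ge0//.
  rewrite ler_pdivrMl ?ltr0n//; apply: (le_trans (ler_norm_sum _ _ _)).
  apply: (@le_trans _ _ (\sum_(i < n) b)).
    by apply: ler_sum => i _; rewrite normrMsign; exact: Gb.
  by rewrite sumr_const card_ord -(mulr_natl b).
have /choice[M MP] : forall sigma, exists H : n.-tuple T -> R, [/\ bounded_measurable H,
    forall x, (Z sigma x <= (H x)%:E)%E, forall x, 0 <= H x <= b &
    ((\int[distribution P XnM]_x H x)%:E <= outer_integral (distribution P XnM) (Z sigma))%E].
  by move=> sigma; exact: outer_integral_attained.
exists M; split.
- by move=> sigma; have [] := MP sigma.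
- move=> sigma g x Gg; have [_ ZM _ _] := MP sigma.
  by rewrite -lee_fin (le_trans (ZP sigma x g Gg)).
- rewrite /rademacher EFinM; apply: lee_wpmul2l; first by rewrite lee_fin invr_ge0 exprn_ge0.
  rewrite -sumEFin; apply: lee_sum => sigma _.
  have [bM _ _ MI] := MP sigma.
  rewrite (Rintegral_distribution P XnM bM) in MI.
  exact: MI.
Qed.

End RademacherEnvelope.

(** * The safe policy *)

(** The inequality [1 + x <= expR x] at [x = -1/2] gives [expR (-1/2) >= 1/2], which is then
    squared. *)
Lemma expR1_le4 {R : realType} : expR 1 <= 4 :> R.
Proof.
have h : (2^-1 : R) <= expR (- 2^-1) by apply: le_trans (expR_ge1Dx _); lra.
have e4 : expR 1 * (expR (- 2^-1) * expR (- 2^-1)) = 1 :> R.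
  by rewrite -!expRD -[RHS]expR0; congr expR; field.
have y4 : 4^-1 <= expR (- 2^-1) * expR (- 2^-1) :> R by nra.
by have := ler_wpM2l (expR_ge0 (1 : R)) y4; rewrite e4; lra.
Qed.

(** The quantity [2 * (2 * C) / n] is the effect of one unit on the mean of score differences, which
    are bounded by [2 * C]. The moment order [p] is the least integer above the logarithm [L]; since
    [L >= 1], it lies between [L] and [2 * L]. *)
Lemma confidence_constants {R : realType} (C delta : R) (K n : nat) :
  0 < C -> (2 <= K)%N -> (0 < n)%N -> 0 < delta <= expR (-1) ->
  let t := 12 * C * Num.sqrt (n%:R^-1 * ln ((K%:R - 1) / delta)) in
  exists p : nat, [/\ expR (- p%:R) <= delta, 0 < t &
    expR 1 * (p%:R * (n%:R * (2 * (2 * C) / n%:R) ^+ 2)) <= t ^+ 2].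
Proof.
move=> C0 K2 n0 /andP[d0 d1] t.
have K1 : 1 <= K%:R - 1 :> R 
  by have := K2; rewrite -(ler_nat R) => ?; lra.
set q := (K%:R - 1) / delta in t *.
have dq : delta^-1 <= q by rewrite /q -[leLHS]mul1r ler_wpM2r// invr_ge0 ltW.
have dI0 : 0 < delta^-1 by rewrite invr_gt0.
have q0 : 0 < q by exact: lt_le_trans dq.
(* The hypotheses [delta <= 1 / e] and [2 <= K] enter here: [q >= 1 / delta >= e]. *)
have L1 : 1 <= ln q.
  rewrite -ler_expR lnK ?posrE//; apply: le_trans dq.
  by rewrite -[expR 1]invrK -expRN lef_pV2 ?posrE// expR_gt0.
set L := ln q in t L1 *.
have L0 : 0 <= L by rewrite (le_trans _ L1).
exists (Num.truncn L).+1; set p := (Num.truncn L).+1.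
have pL : L <= p%:R by apply/ltW/truncnS_gt.
have p2L : p%:R <= 2 * L.
  have : (Num.truncn L)%:R <= L by rewrite truncn_le.
  by rewrite /p -natr1; lra.
have nR : 0 < (n%:R : R) by rewrite ltr0n.
have s0 : 0 < n%:R^-1 * L by rewrite mulr_gt0 ?invr_gt0// (lt_le_trans _ L1).
split.
- apply: (@le_trans _ _ (expR (- L))); first by rewrite ler_expR lerN2.
  rewrite expRN lnK ?posrE//.
  by rewrite -[leRHS]invrK lef_pV2 ?posrE.
- by rewrite !mulr_gt0 ?sqrtr_gt0.
have -> : t ^+ 2 = (12 * C) ^+ 2 * (n%:R^-1 * L) by rewrite /t exprMn sqr_sqrtr// ltW.
have -> : (n%:R : R) * (2 * (2 * C) / n%:R) ^+ 2 = 16 * C ^+ 2 * n%:R^-1.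
  by field; rewrite gt_eqF.
set x := C ^+ 2 * n%:R^-1.
have x0 : 0 <= x by rewrite mulr_ge0 ?sqr_ge0 ?invr_ge0 ?ltW.
have -> : (12 * C) ^+ 2 * (n%:R^-1 * L) = 144 * L * x by rewrite /x; ring.
have -> : expR 1 * (p%:R * (16 * C ^+ 2 / n%:R)) = 16 * (expR 1 * p%:R) * x.
  by rewrite /x; ring.
apply: ler_wpM2r => //.
(* The left-hand coefficient is then at most [16 * 8 * L = 128 * L], below [144 * L]. *)
have : expR 1 * p%:R <= 4 * (2 * L).
  by apply: ler_pM => //; exact: expR1_le4.
by lra.
Qed.

Lemma iid_law_distribution {d d' : measure_display} {Omega : measurableType d}
  {S : measurableType d'} {R : realType} (P : probability Omega R) (n : nat)
  (W0 : {RV P >-> S}) (W : 'I_n -> {RV P >-> S}) (Wn : {mfun Omega >-> n.-tuple S}) :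
  (forall i, identically_distributed (W i) W0) -> mutually_independent W ->
  (forall w, Wn w = [tuple W i w | i < n]) ->
  iid_law (distribution P W0) (distribution P Wn).
Proof.
move=> hid hind WnE B mB.
rewrite (_ : distribution P Wn (cylinder B) = P (\bigcap_i (W i @^-1` B i))).
  by rewrite hind//; apply: eq_bigr => i _; exact: hid.
congr (P _); apply/seteqP; split => w /=.
  by move=> h i _; have := h i; rewrite WnE tnth_mktuple.
by move=> h i; rewrite WnE tnth_mktuple; exact: h.
Qed.

Lemma Rintegral_sample_mean {d d' : measure_display} {Omega : measurableType d}
  {S : measurableType d'} {R : realType} (P : probability Omega R) (n : nat)
  (W0 : {RV P >-> S}) (W : 'I_n -> {RV P >-> S}) (Wn : {mfun Omega >-> n.-tuple S})
  (f : S -> R) : (0 < n)%N ->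
  (forall i, identically_distributed (W i) W0) ->
  (forall w, Wn w = [tuple W i w | i < n]) -> bounded_measurable f ->
  \int[distribution P Wn]_x sample_mean f x = \int[P]_w f (W0 w).
Proof.
move=> n0 hid WnE bf.
rewrite (Rintegral_bmZ (distribution P Wn)); last first.
  by apply: bounded_measurable_sum => i _; exact: bounded_measurable_tnth.
rewrite Rintegral_bm_sum; last by move=> i _; exact: bounded_measurable_tnth.
rewrite (eq_bigr (fun=> \int[P]_w f (W0 w))).
  by rewrite sumr_const card_ord -(mulr_natl (\int[P]_w _)) mulKf// pnatr_eq0 -lt0n.
move=> i _; rewrite (Rintegral_distribution P Wn); last exact: bounded_measurable_tnth.
rewrite -(Rintegral_distribution P W0 bf).
transitivity (\int[P]_w f (W i w)).
  by apply: eq_Rintegral => w _; rewrite WnE tnth_mktuple.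
rewrite -(Rintegral_distribution P (W i) bf); congr fine.
by apply: eq_measure_integral => A mA _; exact: hid.
Qed.

Section SafePolicy.
Context {R : realType} {d d' : measure_display} {Omega : measurableType d}
  {T : measurableType d'} (P : probability Omega R) (K n : nat).
Local Notation unit_type := (K.-tuple bool * T)%type.
Context (W0 : {RV P >-> unit_type}) (W : 'I_n -> {RV P >-> unit_type})
  (u : bool -> 'I_K -> R) (pit : T -> 'I_K) (m : 'I_K -> T -> R) (Pi : set (T -> 'I_K)).

Lemma empirical_value_mean (pi : T -> 'I_K) (w : Omega) :
  empirical_value u pit W w pi m = sample_mean (score u pit pi m) [tuple W i w | i < n].
Proof. by congr (_ * _); apply: eq_bigr => i _; rewrite tnth_mktuple. Qed.

(** The objective vanishes at the baseline for every model, so the maximin value is nonnegative; it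
    bounds from below the objective of [pih] at [m], a member of the class. *)
Lemma empirical_safe_policy_improves (Mh : set ('I_K -> T -> R)) (w : Omega) (pih : T -> 'I_K) :
  Pi pit -> Mh m -> empirical_safe_policy u pit W Pi Mh w pih ->
  empirical_value u pit W w pit m <= empirical_value u pit W w pih m.
Proof.
move=> Ppit Mm [Ppih [worst [wmin wle]]].
have [[m0 Mm0 wE] _] := wmin pit Ppit.
have [_ wlb] := wmin pih Ppih.
have := le_trans (wle pit Ppit) (wlb m Mm).
by rewrite -wE subrr subr_ge0.
Qed.

Hypotheses (hK : (2 <= K)%N) (hn : (0 < n)%N)
  (hid : forall i, identically_distributed (W i) W0) (hind : mutually_independent W)
  (hPi : forall pi, Pi pi -> measurable_policy pi) (hpit : Pi pit)
  (m01 : forall a x, 0 <= m a x <= 1) (mm : forall a, measurable_fun setT (m a)).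

Local Notation C := (utility_bound u).
Local Notation rho := (\big[maxe/0]_(a < K)
  rademacher P (fun i w => (W i w).2) (policy_class_at Pi a))%E.

(** The event is chosen before [pi], so the bound may be applied to a policy that depends on the
    data. *)
Lemma safe_policy_deviation (delta : R) : 0 < C -> 0 < delta <= expR (-1) ->
  exists E : set Omega, [/\ measurable E, ((1 - delta)%:E <= P E)%E &
   forall w pi, E w -> Pi pi ->
     ((value u pit W0 pit m - value u pit W0 pi m -
       (empirical_value u pit W w pit m - empirical_value u pit W w pi m))%:E <=
       (6 * C * (K%:R - 1))%:E *
       (rho + (2 * Num.sqrt (n%:R^-1 * ln ((K%:R - 1) / delta)))%:E))%E].
Proof.
move=> C0 hdelta.
have [p [pdelta t0 pt]] := confidence_constants C0 hK hn hdelta.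
set t := 12 * C * _ in t0 pt.
pose Wf (w : Omega) : n.-tuple unit_type := [tuple W i w | i < n].
have mWf : measurable_fun setT Wf.
  apply/measurable_fun_tnthP => i; rewrite (_ : _ \o _ = W i)//.
  by apply/funext => w /=; rewrite tnth_mktuple.
pose Wn : {mfun Omega >-> n.-tuple unit_type} := HB.pack Wf (isMeasurableFun.Build _ _ _ _ Wf mWf).
have WnE w : Wn w = [tuple W i w | i < n] by [].
have hnu := iid_law_distribution hid hind WnE.
set nu : probability _ R := distribution P Wn in hnu.
pose a0 : 'I_K := Ordinal (ltnW hK).
pose pay := arm_payoff u pit m.
(* Two payoffs differ by at most [2 * C], so this normalization gives multipliers with values in
   [-1, 1]. *)
pose h a s := (2 * C)^-1 * (pay a s - pay a0 s).
have C20 : 0 < 2 * C by rewrite mulr_gt0.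
have bpay a : bounded_measurable (pay a) by apply: bounded_measurable_arm_payoff => //; exact: hPi.
have bh a : bounded_measurable (h a).
  by apply: bounded_measurableM; [exact: bounded_measurable_cst|exact: bounded_measurableB].
have h1 a s : `|h a s| <= 1.
  rewrite /h normrM gtr0_norm ?invr_gt0// ler_pdivrMl// mulr1.
  have := norm_arm_payoff u pit m01 a s; have := norm_arm_payoff u pit m01 a0 s.
  by move=> ? ?; rewrite (le_trans (ler_normB _ _))//; lra.
have bind pi a : Pi pi -> bounded_measurable (policy_ind pi a : T -> R).
  by move=> /hPi; exact: bounded_measurable_policy_ind.
(* The real number [r a] stands in for the extended-real complexity, so that the estimates up to the
   final comparison take place in [R]. *)
have /choice[r rP] : forall a, exists r : R,
    (r%:E <= rademacher P (fun i w => (W i w).2) (policy_class_at Pi a))%E /\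
    exists G : n.-tuple unit_type -> R, [/\ bounded_measurable G,
      forall pi x, Pi pi -> sample_mean (fun s => h a s * policy_ind pi a s.2) x -
        \int[nu]_y sample_mean (fun s => h a s * policy_ind pi a s.2) y <= G x &
      \int[nu]_x G x = 2 * r].
  move=> a.
  have [M [bM MP Mr]] : exists M : {ffun 'I_n -> bool} -> n.-tuple T -> R,
      [/\ forall sigma, bounded_measurable (M sigma),
      forall (sigma : {ffun 'I_n -> bool}) g x, policy_class_at Pi a g ->
        `|n%:R^-1 * \sum_(i < n) (-1) ^+ sigma i * g (tnth x i)| <= M sigma x &
      (((2 ^+ n)^-1 * \sum_sigma \int[P]_w M sigma [tuple (W i w).2 | i < n])%:E
        <= rademacher P (fun i w => (W i w).2) (policy_class_at Pi a))%E].
    apply: (@rademacher_envelope _ _ _ _ _ P n (fun i w => (W i w).2) _ 1) => //.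
    - by move=> i; exact: (measurableT_comp measurable_snd).
    - by exists (policy_ind pit a); exists pit.
    - by move=> _ [pi _ <-] x; rewrite /policy_ind; case: eqP; rewrite ?normr1 ?normr0.
  eexists; split; first exact: Mr.
  have [] := @weighted_symmetrization _ _ _ _ _ nu hnu _ _ (fun s : unit_type => s.2)
    (h a) (policy_class_at Pi a) M.
  - exact: measurable_snd.
  - by have [] := bh a.
  - exact: h1.
  - by move=> _ [pi Ppi <-]; exact: bind.
  - exact: bM.
  - exact: MP.
  move=> G [bG GP GE]; exists G; split => //.
    by move=> pi x Ppi; apply: GP; exists pi.
  rewrite GE; congr (_ * (_ * _)); apply: eq_bigr => sigma _.
  rewrite (Rintegral_distribution P Wn).
    apply: eq_Rintegral => w _; congr (M sigma _).
    by apply: eq_from_tnth => i; rewrite !tnth_mktuple ?WnE ?tnth_mktuple.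
  exact: (bounded_measurable_comp (bM sigma) (measurable_tuple_map measurable_snd)).
have /choice[G GP] := fun a => (rP a).2.
have {}rP a := (rP a).1.
pose psi pi a (s : unit_type) := h a s * policy_ind pi a s.2.
have bpsi pi a : Pi pi -> bounded_measurable (psi pi a).
  move=> Ppi; apply: bounded_measurableM => //.
  exact: (bounded_measurable_comp (bind pi a Ppi) measurable_snd).
pose phi pi s := \sum_(a < K | a != a0) (2 * C) * psi pi a s.
have bphi pi : Pi pi -> bounded_measurable (phi pi).
  move=> Ppi; apply: bounded_measurable_sum => a _; apply: bounded_measurableM.
    exact: bounded_measurable_cst.
  exact: bpsi.
have scoreP pi s : score u pit pi m s = pay a0 s + phi pi s.
  rewrite (score_contrast u pit m a0); congr (_ + _); apply: eq_bigr => a _.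
  by rewrite /psi /h !mulrA mulfV ?mul1r// gt_eqF.
pose f pi s := score u pit pit m s - score u pit pi m s.
have fE pi : f pi = (fun s => phi pit s - phi pi s).
  by apply/funext => s; rewrite /f !scoreP; ring.
have bf pi : Pi pi -> bounded_measurable (f pi).
  by move=> Ppi; rewrite fE; apply: bounded_measurableB; exact: bphi.
have bmean g : bounded_measurable g ->
    bounded_measurable (sample_mean g : n.-tuple unit_type -> R).
  exact: bounded_measurable_sample_mean.
pose mphi pi (x : n.-tuple unit_type) := sample_mean (phi pi) x - \int[nu]_y sample_mean (phi pi) y.
have bmphi pi : Pi pi -> bounded_measurable (mphi pi).
  move=> Ppi; apply: bounded_measurableB; last exact: bounded_measurable_cst.
  exact/bmean/bphi.
(* The centred mean [mphi pit] of the fixed baseline is kept as it stands instead of being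
   symmetrized: it integrates to zero, so it adds nothing to the mean of [Gt]. *)
pose Gt x := \sum_(a < K | a != a0) (2 * C) * G a x - mphi pit x.
have bG a : bounded_measurable (G a) by have [] := GP a.
have bCG a : bounded_measurable (fun x => (2 * C) * G a x).
  by apply: bounded_measurableM => //; exact: bounded_measurable_cst.
have bSG : bounded_measurable (fun x => \sum_(a < K | a != a0) (2 * C) * G a x).
  exact: bounded_measurable_sum.
have bGt : bounded_measurable Gt by apply: bounded_measurableB => //; exact: bmphi.
have GtE : \int[nu]_x Gt x = \sum_(a < K | a != a0) (2 * C) * (2 * r a).
  rewrite (Rintegral_bmB nu bSG (bmphi _ hpit)).
  have -> : \int[nu]_x mphi pit x = 0.
    rewrite (Rintegral_bmB nu (bmean _ (bphi _ hpit)) (bounded_measurable_cst _)).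
    by rewrite Rintegral_bm_cst subrr.
  rewrite subr0 Rintegral_bm_sum//; apply: eq_bigr => a _.
  by rewrite Rintegral_bmZ//; have [_ _ ->] := GP a.
pose Psi := [set g : unit_type -> R | exists2 pi, Pi pi & g = f pi].
have [||||E [mE nuE EP]] := @uniform_deviation _ _ _ _ _ nu hnu hn Psi (2 * C) t p Gt _ _ _ _ t0 pt.
- move=> _ [pi Ppi ->]; split; first exact: bf.
  move=> s; apply: (le_trans (ler_normB _ _)).
  have := norm_score u pit m01 pit s; have := norm_score u pit m01 pi s; lra.
- by exists pit => //; apply/funext => s; rewrite /f subrr.
- exact: bGt.
- move=> _ x [pi Ppi ->].
  have mfE (y : n.-tuple unit_type) : sample_mean (f pi) y = sample_mean (phi pit) y - sample_mean (phi pi) y.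
    by rewrite fE sample_meanB.
  have -> : \int[nu]_y sample_mean (f pi) y - sample_mean (f pi) x = mphi pi x - mphi pit x.
    rewrite mfE (eq_Rintegral _ (fun y _ => mfE y)).
    rewrite (Rintegral_bmB nu (bmean _ (bphi _ hpit)) (bmean _ (bphi _ Ppi))).
    by rewrite /mphi; ring.
  rewrite /Gt lerD2r /mphi sample_mean_sum.
  have -> : \int[nu]_y sample_mean (phi pi) y =
      \sum_(a < K | a != a0) (2 * C) * \int[nu]_y sample_mean (psi pi a) y.
    under eq_Rintegral do rewrite sample_mean_sum.
    rewrite Rintegral_bm_sum.
      apply: eq_bigr => a _; rewrite Rintegral_bmZ//; exact/bmean/bpsi.
    move=> a _; apply: bounded_measurableM; first exact: bounded_measurable_cst.
    exact/bmean/bpsi.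
  rewrite -sumrB; apply: ler_sum => a _; rewrite -mulrBr ler_wpM2l ?(ltW C20)//.
  by have [_ GaP _] := GP a; exact: GaP.
exists (Wn @^-1` E); split.
- by rewrite -[X in measurable X]setTI; exact: (measurable_funPT Wn).
- apply: le_trans nuE; rewrite lee_fin lerB//.
move=> w pi Ew Ppi.
have fPsi : Psi (f pi) by exists pi.
have := EP (Wn w) (f pi) Ew fPsi; rewrite GtE.
have bsc p' : Pi p' -> bounded_measurable (score u pit p' m).
  by move=> Pp'; apply: bounded_measurable_score => //; exact: hPi.
have mfE (y : n.-tuple unit_type) : sample_mean (f pi) y =
    sample_mean (score u pit pit m) y - sample_mean (score u pit pi m) y.
  by rewrite sample_meanB.
rewrite mfE (eq_Rintegral _ (fun y _ => mfE y)).
rewrite (Rintegral_bmB nu (bmean _ (bsc _ hpit)) (bmean _ (bsc _ Ppi))).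
rewrite (Rintegral_sample_mean hn hid WnE (bsc _ hpit)).
rewrite (Rintegral_sample_mean hn hid WnE (bsc _ Ppi)).
rewrite !empirical_value_mean => dev.
apply: (@le_trans _ _ (\sum_(a < K | a != a0) 2 * C * (2 * r a) + t)%:E).
  by rewrite lee_fin; exact: dev.
have rho0 : (0 <= rho)%E by exact: bigmax_ge_id.
have rrho a : ((r a)%:E <= rho)%E.
  exact: (le_trans (rP a) (le_bigmax _ (fun a => rademacher P (fun i w => (W i w).2) (policy_class_at Pi a)) a)).
have K1 : 1 <= K%:R - 1 :> R by have := hK; rewrite -(ler_nat R) => ?; lra.
(* If the maximum is infinite, so is the right-hand side, whose coefficient is positive. *)
case: rho rho0 rrho => [v| |] //= v0 rv; last first.
  rewrite addye// mulry gtr0_sg ?mul1e ?leey// mulr_gt0// ?mulr_gt0//; lra.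
rewrite -EFinD -EFinM lee_fin; rewrite lee_fin in v0.
have {}rv a : r a <= v by have := rv a; rewrite lee_fin.
have sumv : \sum_(a < K | a != a0) 2 * C * (2 * r a) <= 4 * C * (K%:R - 1) * v.
  apply: (@le_trans _ _ (\sum_(a < K | a != a0) 4 * C * v)).
    by apply: ler_sum => a _; have := ler_wpM2l (ltW C20) (rv a); lra.
  rewrite sumr_const cardC1 card_ord -(mulr_natl (4 * C * v)).
  by rewrite -subn1 natrB ?(ltnW hK)//; lra.
rewrite /t; set q := Num.sqrt _.
have q0 : 0 <= q by exact: sqrtr_ge0.
(* Since [K - 1 >= 1], the term [12 * C * q] is at most [6 * C * (K - 1) * (2 * q)]; in the
   complexity term the constant 4 is relaxed to 6. *)
have CK : C <= C * (K%:R - 1) by rewrite ler_peMr// ltW.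
have CKv : 0 <= C * (K%:R - 1) * v by rewrite !mulr_ge0// ?(ltW C0)//; lra.
have CKq := ler_wpM2r q0 CK.
apply: (le_trans (lerD sumv (lexx _))); lra.
Qed.

End SafePolicy.

Theorem theorem1 (R : realType)
  (d d' : measure_display) (Omega : measurableType d) (T : measurableType d')
  (P : probability Omega R)
  (K n : nat) (hK : (2 <= K)%N) (hn : (0 < n)%N)
  (W0 : {RV P >-> (K.-tuple bool * T)%type})
  (W : 'I_n -> {RV P >-> (K.-tuple bool * T)%type})
  (hW_id : forall i, identically_distributed (W i) W0)
  (hW_indep : mutually_independent W)
  (u : bool -> 'I_K -> R) (hu : forall a, 0 <= utility_gain u a)
  (Pi : set (T -> 'I_K)) (hPi : forall pi, Pi pi -> measurable_policy pi)
  (pit : T -> 'I_K) (hpit : Pi pit)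
  (mstar : 'I_K -> T -> R) (hmstar : is_regression W0 mstar)
  (F : set ('I_K -> T -> R))
  (hF : forall f, F f -> forall a x, 0 <= f a x <= 1)
  (hM : restricted_class pit F (baseline_regression pit mstar) mstar)
  (alpha : R) (Mhat : Omega -> set ('I_K -> T -> R))
  (hMhat : with_prob_ge P (1 - alpha)
    [set w | restricted_class pit F (baseline_regression pit mstar) `<=` Mhat w])
  (pihat : Omega -> T -> 'I_K)
  (hpihat : forall w, empirical_safe_policy u pit W Pi (Mhat w) w (pihat w))
  (delta : R) (hdelta : 0 < delta <= expR (-1)) :
  with_prob_ge P (1 - alpha - delta)
    [set w |
      ((value u pit W0 pit mstar - value u pit W0 (pihat w) mstar)%:E <=
       (6 * utility_bound u * (K%:R - 1))%:E *
       (\big[maxe/0]_(a < K)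
          rademacher P (fun i w' => (W i w').2) (policy_class_at Pi a)
        + (2 * Num.sqrt (n%:R^-1 * ln ((K%:R - 1) / delta)))%:E))%E].
Proof.
have m01 : forall a x, 0 <= mstar a x <= 1 by apply: hF; case: hM.
have mm a : measurable_fun setT (mstar a) by have [] := hmstar a.
have [Ea [mEa EaM PEa]] := hMhat.
have Pih w : Pi (pihat w) by have [] := hpihat w.
have /andP[d0 _] := hdelta.
(* The case [C = 0] is separate because the contrasts are normalized by [2 * C]; then all scores
   vanish, and so does the right-hand side. *)
have := utility_bound_ge0 u; rewrite le_eqVlt => /orP[/eqP C0|C0].
  exists Ea; split => //; last first.
    by apply: le_trans PEa; rewrite lee_fin; lra.
  move=> w _ /=; rewrite -C0 mulr0 mul0r mul0e lee_fin.
  have s0 pi s : score u pit pi mstar s = 0.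
    by apply/eqP; rewrite -normr_le0 C0; exact: norm_score.
  have v0 pi : value u pit W0 pi mstar = 0.
    by rewrite /value -[RHS](Rintegral_bm_cst P); apply: eq_Rintegral => w' _; exact: s0.
  by rewrite !v0 subrr.
have [E [mE PE EP]] :=
  safe_policy_deviation hK hn hW_id hW_indep hPi hpit m01 mm C0 hdelta.
exists (Ea `&` E); split; first exact: measurableI.
- move=> w [Eaw Ew] /=; apply: le_trans (EP w (pihat w) Ew (Pih w)).
  (* The empirical regret subtracted in the deviation bound is at most zero, so that bound also
     covers the true regret. *)
  rewrite lee_fin lerDl oppr_ge0 subr_le0.
  apply: (empirical_safe_policy_improves hpit _ (hpihat w)).
  exact: (EaM w Eaw).
(* Union bound: [Ea] is covered by its intersection with [E] and by the complement of [E]. *)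
- have PEC : (P (~` E) <= delta%:E)%E.
    rewrite probability_setC// leeBlDl ?fin_num_measure//.
    by move: PE; rewrite EFinB leeBlDr.
  have : (P Ea <= P (Ea `&` E) + P (~` E))%E.
    apply: (le_trans _ (measureU2 _ _ _)); [|exact: measurableI|exact: measurableC].
    apply: le_measure; rewrite ?inE//.
      by apply: measurableU; [exact: measurableI|exact: measurableC].
    by move=> w Eaw; have [Ew|nEw] := pselect (E w); [left|right].
  move=> h; rewrite EFinB leeBlDr//; apply: (le_trans PEa); apply: (le_trans h).
  exact: leeD2l.
Qed.
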